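(* Let $(X,\mu)$ be a probability space with an ergodic flow $g_t$ ($t\in\mathbb{R}$), and let $G_2$ denote the split real Lie group of type $G_2$. Let $P\to X$ be a principal $G_2$-bundle to which the flow $g_t$ lifts, let $\rho_{std}: G_2\to GL_7(\mathbb{R})$ be the standard $7$-dimensional representation, and let $W_{std}=P\times_{G_2}\mathbb{R}^7\to X$ be the associated vector bundle, with the induced lift $g_t(x):(W_{std})_x\to (W_{std})_{g_t x}$ of the flow. Suppose that the lift satisfies the integrability condition $$\int_X \sup_{t\in[-1,1]}\|g_t(x)\|\,d\mu(x)<\infty .$$ Then there exist real numbers $\lambda_1,\lambda_2,\lambda_3$ such that the Lyapunov exponents of the flow $g_t$ on $W_{std}$, listed with multiplicity, are the seven numbers $$0,\quad \pm(\lambda_1-\lambda_2),\quad \pm(\lambda_1-\lambda_3),\quad \pm(\lambda_2-\lambda_3).$$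
   Context: Principal bundles: $P\to X$ is a (measurable) principal bundle with a right $G_2$-action; a lift of the flow to $P$ is a (measurable) flow on $P$ covering $g_t$ and commuting with the right $G_2$-action. For a representation $\rho:G\to GL_n(\mathbb{R})$ of a Lie group $G$ and a principal $G$-bundle $P$, the associated bundle $P\times_G\mathbb{R}^n$ is the quotient of $P\times\mathbb{R}^n$ by the identification $(p,v)\sim(pg,\rho(g^{-1})v)$ for $g\in G$; a lift of the flow to $P$ induces a lift to $P\times_G\mathbb{R}^n$ acting linearly on fibers. Standard representation: $\rho_{std}$ is the $7$-dimensional fundamental representation of $G_2$. Its weights are $0$, $\pm(e_1-e_2)$, $\pm(e_1-e_3)$, $\pm(e_2-e_3)$, i.e. $0$ and the six short roots, where the root system of type $G_2$ is realized in $\mathbb{R}^3$ with standard basis $e_1,e_2,e_3$ as $\pm(e_i-e_j)$ for $i<j$, $\pm(2e_1-e_2-e_3)$, $\pm(-e_1+2e_2-e_3)$, $\pm(e_1+e_2-2e_3)$. The real form considered is the one whose restricted root system is also of type $G_2$ (the split form). Norm: $W_{std}$ is equipped with a (measurable) norm $\|\cdot\|$ on its fibers, and $\|g_t(x)\|$ in the integrability condition denotes the operator norm of $g_t(x):(W_{std})_x\to(W_{std})_{g_tx}$. Lyapunov exponents: for a finite-rank real vector bundle $V\to X$ with a norm and a lift of an ergodic flow $g_t$ satisfying the integrability condition, Oseledets' theorem gives numbers $\chi_1>\chi_2>\dots>\chi_m$ and a measurable $g_t$-invariant decomposition $V_x=\bigoplus_i V_x^{\chi_i}$ such that for $\mu$-a.e.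 $x$ and every nonzero $v\in V_x^{\chi_k}$, $\lim_{t\to\pm\infty}\frac1t\log\|g_t(x)v\|=\chi_k$. The numbers $\chi_k$ are the Lyapunov exponents; listed with multiplicity, each $\chi_k$ is repeated $\dim V_x^{\chi_k}$ times. *)

(* Defs.v *)
From HB Require Import structures.
From mathcomp Require Import all_boot all_order all_algebra.
From mathcomp Require Import all_classical all_reals all_analysis.
From mathcomp Require Import ring.

Set Implicit Arguments.
Unset Strict Implicit.
Unset Printing Implicit Defensive.

Import Order.TTheory GRing.Theory Num.Theory.
Import numFieldNormedType.Exports.

Local Open Scope classical_set_scope.
Local Open Scope ring_scope.

(* Matrices with the Borel sigma-algebra of their usual topology. *)
Definition borel_mx (R : realType) (m n : nat) :=
  g_sigma_algebraType (@open 'M[R]_(m, n)).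

(* The split octonions, as Zorn's vector matrices ( a  u ; v  b ) with
   a, b scalars and u, v vectors of R^3. *)
Record zorn (R : realType) :=
  Zorn { zorn_a : R; zorn_u : 'cV[R]_3; zorn_v : 'cV[R]_3; zorn_b : R }.

Section split_octonions.
Context {R : realType}.
Implicit Types (x y : zorn R) (u v : 'cV[R]_3).

Definition dot3 u v : R := \sum_i u i 0 * v i 0.

(* Indices are in 'I_3, hence added modulo 3. *)
Definition cross3 u v : 'cV[R]_3 :=
  \col_i (u (i + 1) 0 * v (i + 2%:R) 0 - u (i + 2%:R) 0 * v (i + 1) 0).

Definition zorn_mul x y : zorn R :=
  let: Zorn a u v b := x in
  let: Zorn a' u' v' b' := y in
  Zorn (a * a' + dot3 u v')
       (a *: u' + b' *: u + cross3 v v')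
       (a' *: v + b *: v' - cross3 u u')
       (b * b' + dot3 v u').

(* An octonion is the sum of its real part and of its imaginary (trace zero)
   part ( c  u ; v  -c ), the latter being coordinatized by (c, u, v) in R^7. *)
Definition zorn_re x : R := (zorn_a x + zorn_b x) / 2%:R.

Definition zorn_im x : 'cV[R]_(1 + (3 + 3)) :=
  col_mx ((zorn_a x - zorn_b x) / 2%:R)%:M (col_mx (zorn_u x) (zorn_v x)).

Definition zorn_of (r : R) (w : 'cV[R]_(1 + (3 + 3))) : zorn R :=
  let c := usubmx w 0 0 in
  Zorn (r + c) (usubmx (dsubmx w)) (dsubmx (dsubmx w)) (r - c).

(* The linear map that fixes 1 and is A on imaginary octonions.  Every
   automorphism of the octonions fixes 1 and preserves the imaginary octonions,
   hence has this form. *)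
Definition zorn_ext (A : 'M[R]_7) x : zorn R :=
  zorn_of (zorn_re x) (A *m zorn_im x).

Definition octonion_aut (A : 'M[R]_7) : Prop :=
  A \in unitmx /\
  forall x y, zorn_ext A (zorn_mul x y) =
              zorn_mul (zorn_ext A x) (zorn_ext A y).

Lemma zorn_re_of r w : zorn_re (zorn_of r w) = r.
Proof.
by rewrite /zorn_re /=; field.
Qed.

Lemma zorn_im_of r w : zorn_im (zorn_of r w) = w.
Proof.
rewrite /zorn_im /= vsubmxK -[RHS]vsubmxK; congr col_mx.
by apply/matrixP => i j; rewrite !ord1 [LHS]mxE eqxx mulr1n; field.
Qed.

Lemma zorn_ofK x : zorn_of (zorn_re x) (zorn_im x) = x.
Proof.
case: x => a u v b; rewrite /zorn_of /zorn_im /zorn_re /=.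
rewrite !col_mxKu !col_mxKd !col_mxKu mxE eqxx mulr1n.
congr Zorn; by field.
Qed.

Lemma zorn_ext1 x : zorn_ext 1%:M x = x.
Proof. by rewrite /zorn_ext mul1mx zorn_ofK. Qed.

Lemma zorn_extM A B x : zorn_ext (A *m B) x = zorn_ext A (zorn_ext B x).
Proof. by rewrite /zorn_ext zorn_re_of zorn_im_of mulmxA. Qed.

Lemma octonion_aut1 : octonion_aut 1%:M.
Proof. by split=> [|x y]; rewrite ?unitmx1// !zorn_ext1. Qed.

Lemma octonion_autM A B :
  octonion_aut A -> octonion_aut B -> octonion_aut (A *m B).
Proof.
move=> [uA mA] [uB mB]; split=> [|x y]; first by rewrite unitmx_mul uA.
by rewrite !zorn_extM mB mA.
Qed.

Lemma octonion_autV A : octonion_aut A -> octonion_aut (invmx A).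
Proof.
move=> [uA mA]; split=> [|x y]; first by rewrite unitmx_inv.
have AK z : zorn_ext A (zorn_ext (invmx A) z) = z.
  by rewrite -zorn_extM mulmxV// zorn_ext1.
have KA z : zorn_ext (invmx A) (zorn_ext A z) = z.
  by rewrite -zorn_extM mulVmx// zorn_ext1.
by rewrite -[in LHS](AK x) -[in LHS](AK y) -mA KA.
Qed.

End split_octonions.

(* The split real group G_2, i.e. the automorphism group of the split
   octonions. *)
Record G2 (R : realType) :=
  MkG2 { G2_mx : 'M[R]_7; G2_mxP : `[< octonion_aut G2_mx >] }.

Section G2_group.
Context {R : realType}.

HB.instance Definition _ := [isSub of G2 R for @G2_mx R].
HB.instance Definition _ := [Choice of G2 R by <:].

Definition G2_one : G2 R := MkG2 (asboolT octonion_aut1).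
Definition G2_mul (a b : G2 R) : G2 R :=
  MkG2 (asboolT (octonion_autM (asboolW (G2_mxP a)) (asboolW (G2_mxP b)))).
Definition G2_inv (a : G2 R) : G2 R :=
  MkG2 (asboolT (octonion_autV (asboolW (G2_mxP a)))).

Lemma G2_unit (a : G2 R) : G2_mx a \in unitmx.
Proof. by have [] := asboolW (G2_mxP a). Qed.

Let mulA : associative G2_mul.
Proof. by move=> a b c; apply/val_inj; rewrite /= mulmxA. Qed.
Let mul1 : left_id G2_one G2_mul.
Proof. by move=> a; apply/val_inj; rewrite /= mul1mx. Qed.
Let mulr1 : right_id G2_one G2_mul.
Proof. by move=> a; apply/val_inj; rewrite /= mulmx1. Qed.
Let mulV : left_inverse G2_one G2_inv G2_mul.
Proof. by move=> a; apply/val_inj; rewrite /= mulVmx// G2_unit. Qed.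
Let mulrV : right_inverse G2_one G2_inv G2_mul.
Proof. by move=> a; apply/val_inj; rewrite /= mulmxV// G2_unit. Qed.

HB.instance Definition _ := isGroup.Build (G2 R) mulA mul1 mulr1 mulV mulrV.
HB.instance Definition _ := isPointed.Build (G2 R) G2_one.

Let G2_borel := g_sigma_algebra_preimageType (@G2_mx R : G2 R -> borel_mx R 7 7).

HB.instance Definition _ := @isMeasurable.Build
  (preimage_display (@G2_mx R : G2 R -> borel_mx R 7 7)) (G2 R)
  (g_sigma_algebra_preimage (@G2_mx R : G2 R -> borel_mx R 7 7))
  (@measurable0 _ G2_borel) (@measurableC _ G2_borel)
  (@bigcupT_measurable _ G2_borel).

End G2_group.

(* The standard representation: G_2 acting on the imaginary octonions.  The
   matrices diag(1, s1, s2, s3, s1^-1, s2^-1, s3^-1) with s1 s2 s3 = 1 form a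
   split maximal torus; the weights are 0 and the six short roots, s1, s2, s3
   being the characters e_1 - e_2, e_2 - e_3, e_3 - e_1. *)
Definition rho_std {R : realType} (a : G2 R) : 'M[R]_7 := G2_mx a.

Section rho_std_theory.
Context {R : realType}.
Implicit Types a b : G2 R.

Lemma rho_std1 : rho_std (1%g : G2 R) = 1%:M.
Proof. by []. Qed.

Lemma rho_stdM a b : rho_std (a * b)%g = rho_std a *m rho_std b.
Proof. by []. Qed.

Lemma rho_stdV a : rho_std a^-1%g = invmx (rho_std a).
Proof. by []. Qed.

End rho_std_theory.

Record is_flow (R : realType) d (T : measurableType d) (f : R -> T -> T) :
    Prop := IsFlow {
  flow0 : forall x, f 0 x = x ;
  flowD : forall s t x, f (s + t) x = f s (f t x) ;
  measurable_flow : measurable_fun setT (fun z : R * T => f z.1 z.2) }.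

Record ergodic_flow (R : realType) d (X : measurableType d)
    (mu : probability X R) (g : R -> X -> X) : Prop := ErgodicFlow {
  ergodic_is_flow : is_flow g ;
  ergodic_preserving : forall t A, measurable A -> mu (g t @^-1` A) = mu A ;
  ergodic_trivial : forall A, measurable A -> (forall t, g t @^-1` A = A) ->
    mu A = 0%E \/ mu A = 1%E }.

(* Measurable principal G_2-bundles: locally trivial over a countable
   measurable cover; over each set U n of the cover, a section s and the map h
   provide the measurable isomorphism (x, a) |-> s x . a from U n * G_2 to the
   part of P above U n, and its measurable inverse p |-> (proj p, h p). *)
Record principal_bundle (R : realType) dX dP (X : measurableType dX)
    (P : measurableType dP) := PrincipalBundle {
  proj : P -> X ;
  act : P -> G2 R -> P ;
  measurable_proj : measurable_fun setT proj ;
  measurable_act : measurable_fun setT (fun z : P * G2 R => act z.1 z.2) ;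
  act1 : forall p, act p 1%g = p ;
  actM : forall p a b, act p (a * b)%g = act (act p a) b ;
  proj_act : forall p a, proj (act p a) = proj p ;
  act_free : forall p a, act p a = p -> a = 1%g ;
  locally_trivial : exists U : nat -> set X,
    [/\ forall n, measurable (U n), \bigcup_n U n = setT &
      forall n, exists (s : X -> P) (h : P -> G2 R),
        [/\ measurable_fun (U n) s, measurable_fun (proj @^-1` U n) h,
            forall x, U n x -> proj (s x) = x &
            forall p, U n (proj p) -> p = act (s (proj p)) (h p)]] }.

Record flow_lift (R : realType) dX dP (X : measurableType dX)
    (P : measurableType dP) (B : principal_bundle R X P) (g : R -> X -> X) :=
  FlowLift {
  lift_fun :> R -> P -> P ;
  lift_is_flow : is_flow lift_fun ;
  lift_proj : forall t p, proj B (lift_fun t p) = g t (proj B p) ;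
  lift_act : forall t p a,
    lift_fun t (act B p a) = act B (lift_fun t p) a }.

Section associated_bundle.
Context {R : realType} {dX dP : measure_display} {X : measurableType dX}
  {P : measurableType dP} (B : principal_bundle R X P).

(* The class of (p, v) for (p, v) ~ (p a, rho_std a^-1 v). *)
Definition assoc_class (p : P) (v : 'cV[R]_7) : set (P * 'cV[R]_7) :=
  [set (act B p a, rho_std a^-1%g *m v) | a in [set: G2 R]].

(* The fiber above x of W_std, the quotient of P * R^7 by ~. *)
Record W_std (x : X) := MkW {
  W_class : set (P * 'cV[R]_7) ;
  W_classP : exists p v, proj B p = x /\ W_class = assoc_class p v }.

Definition W_of (x : X) (p : P) (px : proj B p = x) (v : 'cV[R]_7) : W_std x :=
  @MkW x (assoc_class p v) (ex_intro _ p (ex_intro _ v (conj px erefl))).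

Lemma W_std_inj x (c c' : W_std x) : W_class c = W_class c' -> c = c'.
Proof.
case: c c' => [c cP] [c' c'P] /= e; rewrite -e in c'P *.
by congr MkW; exact: Prop_irrelevance.
Qed.

Lemma assoc_class_act p a v :
  assoc_class (act B p a) (rho_std a^-1%g *m v) = assoc_class p v.
Proof.
apply/seteqP; split=> _ [b _ <-].
  by exists (a * b)%g => //; rewrite actM invgM rho_stdM mulmxA.
exists (a^-1 * b)%g => //; rewrite -actM mulVKg; congr pair.
by rewrite mulmxA -rho_stdM invgM invgK mulgK.
Qed.

Lemma W_of_act x p (px : proj B p = x) a (pax : proj B (act B p a) = x) v :
  W_of pax (rho_std a^-1%g *m v) = W_of px v.
Proof. by apply: W_std_inj; exact: assoc_class_act. Qed.

Lemma act_transitive p q : proj B p = proj B q -> exists a, q = act B p a.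
Proof.
move=> pq; have [U [_ UT triv]] := locally_trivial B.
have [n _ Unp] : (\bigcup_n U n) (proj B p) by rewrite UT.
have [s [h [_ _ _ sh]]] := triv n.
exists ((h p)^-1 * h q)%g; rewrite actM.
have -> : act B p (h p)^-1%g = s (proj B p).
  by rewrite {1}(sh _ Unp) -actM mulgV act1.
by rewrite pq; apply: sh; rewrite -pq.
Qed.

Lemma frame_exists x : exists p, proj B p = x.
Proof.
have [U [_ UT triv]] := locally_trivial B.
have [n _ Unx] : (\bigcup_n U n) x by rewrite UT.
by have [s [h [_ _ sx _]]] := triv n; exists (s x); exact: sx.
Qed.

Lemma W_of_inj x p (px : proj B p = x) : injective (W_of px).
Proof.
move=> v w /(congr1 (@W_class x)) /= e.
have : assoc_class p v (p, v).
  by exists 1%g => //; rewrite act1 invg1 rho_std1 mul1mx.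
rewrite e => -[a _ [/act_free a1 <-]]; rewrite a1.
by rewrite invmx1 mul1mx.
Qed.

Lemma W_of_surj x p (px : proj B p = x) (c : W_std x) : exists v, W_of px v = c.
Proof.
have [q [w [qx cE]]] := W_classP c.
have [a pE] : exists a, p = act B q a by apply: act_transitive; rewrite px.
exists (rho_std a^-1%g *m w); apply: W_std_inj; rewrite /= cE pE.
exact: assoc_class_act.
Qed.

Definition coord x p (px : proj B p = x) (c : W_std x) : 'cV[R]_7 :=
  sval (cid (W_of_surj px c)).

Lemma coordK x p (px : proj B p = x) : cancel (coord px) (W_of px).
Proof. by move=> c; rewrite /coord; case: cid. Qed.

Lemma W_ofK x p (px : proj B p = x) : cancel (W_of px) (coord px).
Proof. by move=> v; apply: (@W_of_inj _ _ px); rewrite coordK. Qed.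

Definition frame x : P := sval (cid (frame_exists x)).

Definition frameP x : proj B (frame x) = x := svalP (cid (frame_exists x)).

HB.instance Definition _ x := gen_eqMixin (W_std x).
HB.instance Definition _ x := gen_choiceMixin (W_std x).

(* The vector space structure of a fiber, read in some frame; it does not
   depend on the frame by W_ofD and W_ofZ below. *)
Section fiber_vector_space.
Variable x : X.
Let f := W_of (frameP x).
Let k := coord (frameP x).
Let fK : cancel f k. Proof. exact: W_ofK. Qed.
Let kK : cancel k f. Proof. exact: coordK. Qed.

Definition W_zero : W_std x := f 0.
Definition W_opp (c : W_std x) : W_std x := f (- k c).
Definition W_add (c c' : W_std x) : W_std x := f (k c + k c').
Definition W_scale (r : R) (c : W_std x) : W_std x := f (r *: k c).

Let addA : associative W_add.
Proof. by move=> a b c; rewrite /W_add !fK addrA. Qed.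
Let addC : commutative W_add.
Proof. by move=> a b; rewrite /W_add addrC. Qed.
Let add0 : left_id W_zero W_add.
Proof. by move=> a; rewrite /W_add fK add0r kK. Qed.
Let addN : left_inverse W_zero W_opp W_add.
Proof. by move=> a; rewrite /W_add fK addNr. Qed.

HB.instance Definition _ := GRing.isZmodule.Build (W_std x) addA addC add0 addN.

Let scaleA a b v : W_scale a (W_scale b v) = W_scale (a * b) v.
Proof. by rewrite /W_scale fK scalerA. Qed.
Let scale1 : left_id 1 W_scale.
Proof. by move=> v; rewrite /W_scale scale1r kK. Qed.
Let scaleDr : right_distributive W_scale +%R.
Proof.
move=> a v w; rewrite /W_scale [v + w]/(W_add v w) [RHS]/(W_add _ _) /W_add.
by rewrite !fK scalerDr.
Qed.
Let scaleDl v : {morph W_scale^~ v: a b / a + b}.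
Proof.
move=> a b; rewrite /W_scale [RHS]/(W_add _ _) /W_add.
by rewrite !fK scalerDl.
Qed.

HB.instance Definition _ :=
  GRing.Zmodule_isLmodule.Build R (W_std x) scaleA scale1 scaleDr scaleDl.

End fiber_vector_space.

Lemma W_ofD x p (px : proj B p = x) v w :
  W_of px (v + w) = W_of px v + W_of px w.
Proof.
have [a pE] : exists a, p = act B (frame x) a.
  by apply: act_transitive; rewrite frameP.
case: _ / (esym pE) px => px.
pose M := rho_std a.
have E u : W_of px u = W_of (frameP x) (M *m u).
  rewrite -(W_of_act (frameP x) px) mulmxA -rho_stdM mulVg rho_std1.
  by rewrite mul1mx.
by rewrite !E [RHS]/(W_add _ _) /W_add !W_ofK mulmxDr.
Qed.

Lemma W_ofZ x p (px : proj B p = x) r v : W_of px (r *: v) = r *: W_of px v.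
Proof.
have [a pE] : exists a, p = act B (frame x) a.
  by apply: act_transitive; rewrite frameP.
case: _ / (esym pE) px => px.
pose M := rho_std a.
have E u : W_of px u = W_of (frameP x) (M *m u).
  rewrite -(W_of_act (frameP x) px) mulmxA -rho_stdM mulVg rho_std1.
  by rewrite mul1mx.
by rewrite !E [RHS]/(W_scale _ _) /W_scale !W_ofK scalemxAr.
Qed.

Lemma coord_linear x p (px : proj B p = x) : linear (coord px).
Proof.
move=> r c c'; apply: (can_inj (@W_ofK _ _ px)).
by rewrite W_ofD W_ofZ !coordK.
Qed.

Lemma W_std_vector_axiom x : Vector.axiom 7 (W_std x).
Proof.
exists (fun c => (coord (frameP x) c)^T).
  by move=> r c c'; rewrite coord_linear linearD linearZ.
exists (fun v => W_of (frameP x) v^T) => [c|v].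
  by rewrite trmxK coordK.
by rewrite W_ofK trmxK.
Qed.

HB.instance Definition _ x :=
  Lmodule_hasFinDim.Build R (W_std x) (W_std_vector_axiom x).

(* The total space of W_std carries the quotient sigma-algebra of P * R^7:
   functions and sets are measurable when their pullback to P * R^7 is. *)
Definition W_quo (z : P * borel_mx R 7 1) : W_std (proj B z.1) :=
  W_of erefl z.2.

Record bundle_norm := BundleNorm {
  bnorm :> forall x, W_std x -> R ;
  ler_bnormD : forall x (v w : W_std x), bnorm (v + w) <= bnorm v + bnorm w ;
  bnormZ : forall x r (v : W_std x), bnorm (r *: v) = `|r| * bnorm v ;
  bnorm0_eq0 : forall x (v : W_std x), bnorm v = 0 -> v = 0 ;
  measurable_bnorm : measurable_fun setT (fun z => bnorm (W_quo z)) }.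

Definition measurable_subbundle (V : forall x, {vspace W_std x}) : Prop :=
  measurable [set z | W_quo z \in V (proj B z.1)].

Section induced_lift.
Context {g : R -> X -> X} (phi : flow_lift B g).

Lemma lift_over t x p : proj B p = x -> proj B (phi t p) = g t x.
Proof. by move=> <-; exact: lift_proj. Qed.

(* g_t(x) maps the class of (p, v) to that of (g_t p, v), for any p above x:
   see W_flowE. *)
Definition W_flow t x (c : W_std x) : W_std (g t x) :=
  W_of (lift_over t (frameP x)) (coord (frameP x) c).

Lemma W_flowE t x p (px : proj B p = x) v :
  W_flow t (W_of px v) = W_of (lift_over t px) v.
Proof.
have [a pE] : exists a, p = act B (frame x) a.
  by apply: act_transitive; rewrite frameP.
case: _ / (esym pE) px => px.
have E u : W_of px u = W_of (frameP x) (rho_std a *m u).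
  rewrite -(W_of_act (frameP x) px) mulmxA -rho_stdM mulVg rho_std1.
  by rewrite mul1mx.
rewrite /W_flow E W_ofK; apply: W_std_inj; rewrite /= lift_act.
rewrite -(assoc_class_act (phi t (frame x)) a) mulmxA -rho_stdM mulVg.
by rewrite rho_std1 mul1mx.
Qed.

Lemma W_flow_linear t x : linear (@W_flow t x).
Proof. by move=> r c c'; rewrite /W_flow coord_linear W_ofD W_ofZ. Qed.

HB.instance Definition _ t x :=
  GRing.isLinear.Build R (W_std x) (W_std (g t x)) *:%R (@W_flow t x)
    (@W_flow_linear t x).

Definition W_flow_norm (N : bundle_norm) t x : \bar R :=
  ereal_sup [set (N (g t x) (W_flow t c))%:E | c in [set c : W_std x | N x c <= 1]].

Definition W_flow_norm_sup (N : bundle_norm) x : \bar R :=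
  ereal_sup [set W_flow_norm N t x | t in [set t : R | -1 <= t <= 1]].

Definition integrable_lift (mu : probability X R) (N : bundle_norm) : Prop :=
  (\int[mu]_x W_flow_norm_sup N x < +oo)%E.

Record oseledets_splitting (mu : probability X R) (N : bundle_norm)
    (m : nat) (chi : 'I_m -> R) (V : 'I_m -> forall x, {vspace W_std x}) :
    Prop := OseledetsSplitting {
  oseledets_gt : forall i j : 'I_m, (i < j)%N -> chi j < chi i ;
  oseledets_measurable : forall i, measurable_subbundle (V i) ;
  oseledets_direct : {ae mu, forall x, (\sum_(i < m) V i x = fullv)%VS /\
    directv (\sum_(i < m) V i x)%VS} ;
  oseledets_invariant : {ae mu, forall x, forall t i,
    (linfun (@W_flow t x) @: V i x)%VS = V i (g t x)} ;
  oseledets_growth : {ae mu, forall x, forall i (v : W_std x),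
    v \in V i x -> v != 0 ->
    (ln (N _ (W_flow t v)) / t @[t --> +oo] --> chi i) /\
    (ln (N _ (W_flow t v)) / t @[t --> -oo] --> chi i)} }.

(* s lists the Lyapunov exponents with multiplicity, in decreasing order.  The
   multiplicity of chi i is the almost everywhere constant rank of V i. *)
Definition lyapunov_exponents (mu : probability X R) (N : bundle_norm)
    (s : seq R) : Prop :=
  exists (m : nat) (chi : 'I_m -> R) (V : 'I_m -> forall x, {vspace W_std x})
    (n : 'I_m -> nat),
    [/\ oseledets_splitting mu N chi V,
        forall i, (0 < n i)%N,
        {ae mu, forall x, forall i, \dim (V i x) = n i} &
        s = flatten [seq nseq (n i) (chi i) | i <- enum 'I_m]].

End induced_lift.

End associated_bundle.

(* Main.v *)
Require Import Defs.
From HB Require Import structures.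
From mathcomp Require Import all_boot all_order all_algebra.
From mathcomp Require Import all_classical all_reals all_analysis.
From mathcomp Require Import measurable_realfun ring lra.

Import Order.TTheory GRing.Theory Num.Theory.
Import numFieldNormedType.Exports.

Set Implicit Arguments.
Unset Strict Implicit.
Unset Printing Implicit Defensive.

Local Open Scope classical_set_scope.
Local Open Scope ring_scope.

Local Notation proj := Defs.proj.

(* Along almost every orbit, Poincare recurrence brings back to arbitrarily
   large positive and negative times a uniform bound of the (G_2-invariant)
   product of imaginary octonions in terms of the norm of W_std.  As growth
   rates add up under a bounded product, the product of the Oseledets spaces of
   exponents a and b lies in the one of exponent a + b: the operator A acting by
   c on the Oseledets space of exponent c is a derivation of the imaginary
   octonions.  Such an A is skew for the norm form of the octonions, so its
   eigenvalues are 0, a, -a, b, -b, c, -c, and (tr A^2)^2 = 4 tr A^4.  The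
   latter factors as (a + b + c)(a + b - c)(a - b + c)(b + c - a) = 0.

   The list of exponents does not depend on the splitting, because the spaces
   of a splitting are determined by the growth rates at a single point. *)

(** * Derivations of the imaginary octonions *)

Section imaginary_product.
Context {R : realType}.
Implicit Types (v w : 'cV[R]_7) (A : 'M[R]_7).

(** For imaginary octonions this is half the commutator, that is, the seven-dimensional cross
    product. *)
Definition im_mul v w : 'cV[R]_7 :=
  zorn_im (zorn_mul (zorn_of 0 v) (zorn_of 0 w)).

Lemma octonion_aut_im_mul A v w : octonion_aut A ->
  A *m im_mul v w = im_mul (A *m v) (A *m w).
Proof.
case=> _ autA; have extA u : zorn_ext A (zorn_of 0 u) = zorn_of 0 (A *m u).
  by rewrite /zorn_ext zorn_re_of zorn_im_of.
by rewrite /im_mul -!extA -autA /zorn_ext zorn_im_of.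
Qed.

(* Coordinate 0 is the diagonal entry, 1 to 3 are those of the upper right
   vector and 4 to 6 those of the lower left one. *)
Definition im_coords (x y : nat -> R) : seq R :=
  [:: (x 1%N * y 4%N + x 2%N * y 5%N + x 3%N * y 6%N
       - (x 4%N * y 1%N + x 5%N * y 2%N + x 6%N * y 3%N)) / 2%:R;
      x 0%N * y 1%N - y 0%N * x 1%N + (x 5%N * y 6%N - x 6%N * y 5%N);
      x 0%N * y 2%N - y 0%N * x 2%N + (x 6%N * y 4%N - x 4%N * y 6%N);
      x 0%N * y 3%N - y 0%N * x 3%N + (x 4%N * y 5%N - x 5%N * y 4%N);
      y 0%N * x 4%N - x 0%N * y 4%N - (x 2%N * y 3%N - x 3%N * y 2%N);
      y 0%N * x 5%N - x 0%N * y 5%N - (x 3%N * y 1%N - x 1%N * y 3%N);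
      y 0%N * x 6%N - x 0%N * y 6%N - (x 1%N * y 2%N - x 2%N * y 1%N)].

Lemma im_mulE v w (i : 'I_7) : im_mul v w i 0 =
  nth 0 (im_coords (fun k => v (inord k) 0) (fun k => w (inord k) 0)) i.
Proof.
pose o : 'I_(1 + (3 + 3)) := lshift (3 + 3) 0.
pose U (k : nat) : 'I_(1 + (3 + 3)) := rshift 1 (lshift 3 (inord k)).
pose V (k : nat) : 'I_(1 + (3 + 3)) := rshift 1 (rshift 3 (inord k)).
have E0 : inord 0 = o by apply/val_inj; rewrite /= inordK.
have E1 : (inord 1 = U 0%N) * (inord 2 = U 1%N) * (inord 3 = U 2%N).
  by do !split; apply/val_inj; rewrite /= !inordK.
have E2 : (inord 4 = V 0%N) * (inord 5 = V 1%N) * (inord 6 = V 2%N).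
  by do !split; apply/val_inj; rewrite /= !inordK.
have D (a b : 'cV[R]_3) : dot3 a b = a (inord 0) 0 * b (inord 0) 0
    + a (inord 1) 0 * b (inord 1) 0 + a (inord 2) 0 * b (inord 2) 0.
  rewrite /dot3 !big_ord_recr big_ord0 /= add0r.
  by do ! [congr (_ * _) | congr (_ + _)]; congr (_ _ _);
    apply/val_inj; rewrite /= inordK.
(* The indices in [cross3] wrap around modulo 3. *)
have C0 : ((inord 0 : 'I_3) + 1 = inord 1) *
    ((inord 0 : 'I_3) + 2%:R = inord 2).
  by split; apply/val_inj; rewrite /= !inordK.
have C1 : ((inord 1 : 'I_3) + 1 = inord 2) *
    ((inord 1 : 'I_3) + 2%:R = inord 0).
  by split; apply/val_inj; rewrite /= !inordK.
have C2 : ((inord 2 : 'I_3) + 1 = inord 0) *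
    ((inord 2 : 'I_3) + 2%:R = inord 1).
  by split; apply/val_inj; rewrite /= !inordK.
rewrite -[i in LHS]inord_val.
case: i => [[|[|[|[|[|[|[|i]]]]]]] // _] /=;
  rewrite ?E0 ?E1 ?E2 /im_mul /zorn_im /o /U /V /=.
all: rewrite ?(@col_mxEu _ 1 (3 + 3) 1) ?(@col_mxEd _ 1 (3 + 3) 1).
all: rewrite ?(@col_mxEu _ 3 3 1) ?(@col_mxEd _ 3 3 1) !mxE ?eqxx ?mulr1n.
all: by rewrite ?D ?C0 ?C1 ?C2 ?mxE; ring.
Qed.

(** Coordinate functions built with [inord] are only controlled below 7, and no other index is
    read. *)
Lemma eq_im_coords (x x' y y' : nat -> R) :
  (forall k, (k < 7)%N -> x k = x' k) -> (forall k, (k < 7)%N -> y k = y' k) ->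
  im_coords x y = im_coords x' y'.
Proof. by move=> ex ey; rewrite /im_coords !ex// !ey. Qed.

(* The matrices of derivations in block form: the lower left and upper right
   3 x 3 blocks are the cross products by -p and by -q, the diagonal ones are a
   trace zero matrix m and its opposite transpose. *)
Definition der_rows (p1 p2 p3 q1 q2 q3 m11 m12 m13 m21 m22 m23 m31 m32 : R) :=
  [:: [:: 0; - q1; - q2; - q3; - p1; - p2; - p3];
      [:: 2%:R * p1; m11; m12; m13; 0; q3; - q2];
      [:: 2%:R * p2; m21; m22; m23; - q3; 0; q1];
      [:: 2%:R * p3; m31; m32; - m11 - m22; q2; - q1; 0];
      [:: 2%:R * q1; 0; p3; - p2; - m11; - m21; - m31];
      [:: 2%:R * q2; - p3; 0; p1; - m12; - m22; - m32];
      [:: 2%:R * q3; p2; - p1; 0; - m13; - m23; m11 + m22]].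

Definition im_derivation A := forall v w,
  A *m im_mul v w = im_mul (A *m v) w + im_mul v (A *m w).

(** The equations needed are kept as premises of the goal, so that after [clear] the linear
    arithmetic sees nothing else. *)
Local Ltac entry := rewrite !big_ord_recr !big_ord0 /=; clear; lra.

(** Evaluating the Leibniz rule on pairs of basis vectors gives linear equations that express 35 of
    the 49 entries through the other 14, in accordance with the dimension of G_2. *)
Lemma im_derivation_rows A : im_derivation A ->
  exists p1 p2 p3 q1 q2 q3 m11 m12 m13 m21 m22 m23 m31 m32 : R,
  forall i j : 'I_7, A i j =
    nth 0 (nth [::] (der_rows p1 p2 p3 q1 q2 q3
                              m11 m12 m13 m21 m22 m23 m31 m32) i) j.
Proof.
move=> derA.
pose F (i j : nat) := A (inord i) (inord j).
pose d (k j : nat) : R := (j == k)%:R.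
(* [E k l i] is coordinate [i] of the Leibniz rule on the basis vectors of indices [k] and [l];
   [d k] gives the coordinates of the former. *)
have E (k l i : nat) : (k < 7)%N -> (l < 7)%N -> (i < 7)%N ->
    \sum_(j < 7) F i j * nth 0 (im_coords (d k) (d l)) j =
    nth 0 (im_coords (fun j => F j k) (d l)) i +
    nth 0 (im_coords (d k) (fun j => F j l)) i.
  move=> k7 l7 i7; pose e (h : nat) : 'cV[R]_7 := delta_mx (inord h) 0.
  have eE h j : (h < 7)%N -> (j < 7)%N -> e h (inord j) 0 = d h j.
    by move=> h7 j7; rewrite mxE eqxx andbT -val_eqE /= !inordK.
  have AeE h j : (A *m e h) (inord j) 0 = F j h.
    by rewrite -colE !mxE.
  have := congr1 (fun M : 'cV_7 => M (inord i) 0) (derA (e k) (e l)).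
  rewrite mxE [RHS]mxE !im_mulE !inordK//.
  have eAe h h' : (h < 7)%N -> (h' < 7)%N ->
      im_coords (fun j => (A *m e h) (inord j) 0) (fun j => e h' (inord j) 0) =
      im_coords (fun j => F j h) (d h').
    by move=> h7 h'7; apply: eq_im_coords => j j7; rewrite (AeE, eE).
  have eeA h h' : (h < 7)%N -> (h' < 7)%N ->
      im_coords (fun j => e h (inord j) 0) (fun j => (A *m e h') (inord j) 0) =
      im_coords (d h) (fun j => F j h').
    by move=> h7 h'7; apply: eq_im_coords => j j7; rewrite (AeE, eE).
  rewrite eAe// eeA// => <-; apply: eq_bigr => j _; rewrite im_mulE /F inord_val.
  by congr (_ * nth _ _ _); apply: eq_im_coords => h h7; rewrite eE.
rewrite /d in E.
have f00 : F 0%N 0%N = 0.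
  by move: (E 0%N 1%N 1%N isT isT isT); entry.
have f01 : F 0%N 1%N = - F 4%N 0%N / 2%:R.
  by move: (E 0%N 1%N 0%N isT isT isT); entry.
have f04 : F 0%N 4%N = - F 1%N 0%N / 2%:R.
  by move: (E 0%N 4%N 0%N isT isT isT); entry.
have f02 : F 0%N 2%N = - F 5%N 0%N / 2%:R.
  by move: (E 0%N 2%N 0%N isT isT isT); entry.
have f05 : F 0%N 5%N = - F 2%N 0%N / 2%:R.
  by move: (E 0%N 5%N 0%N isT isT isT); entry.
have f03 : F 0%N 3%N = - F 6%N 0%N / 2%:R.
  by move: (E 0%N 3%N 0%N isT isT isT); entry.
have f06 : F 0%N 6%N = - F 3%N 0%N / 2%:R.
  by move: (E 0%N 6%N 0%N isT isT isT); entry.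
have f41 : F 4%N 1%N = 0.
  by move: (E 0%N 1%N 4%N isT isT isT); entry.
have f14 : F 1%N 4%N = 0.
  by move: (E 0%N 4%N 1%N isT isT isT); entry.
have f51 : F 5%N 1%N = - F 3%N 0%N / 2%:R.
  by move: (E 0%N 1%N 5%N isT isT isT); entry.
have f24 : F 2%N 4%N = - F 6%N 0%N / 2%:R.
  by move: (E 0%N 4%N 2%N isT isT isT); entry.
have f61 : F 6%N 1%N = F 2%N 0%N / 2%:R.
  by move: (E 0%N 1%N 6%N isT isT isT); entry.
have f34 : F 3%N 4%N = F 5%N 0%N / 2%:R.
  by move: (E 0%N 4%N 3%N isT isT isT); entry.
have f42 : F 4%N 2%N = F 3%N 0%N / 2%:R.
  by move: (E 0%N 2%N 4%N isT isT isT); entry.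
have f15 : F 1%N 5%N = F 6%N 0%N / 2%:R.
  by move: (E 0%N 5%N 1%N isT isT isT); entry.
have f52 : F 5%N 2%N = 0.
  by move: (E 0%N 2%N 5%N isT isT isT); entry.
have f25 : F 2%N 5%N = 0.
  by move: (E 0%N 5%N 2%N isT isT isT); entry.
have f62 : F 6%N 2%N = - F 1%N 0%N / 2%:R.
  by move: (E 0%N 2%N 6%N isT isT isT); entry.
have f35 : F 3%N 5%N = - F 4%N 0%N / 2%:R.
  by move: (E 0%N 5%N 3%N isT isT isT); entry.
have f43 : F 4%N 3%N = - F 2%N 0%N / 2%:R.
  by move: (E 0%N 3%N 4%N isT isT isT); entry.
have f16 : F 1%N 6%N = - F 5%N 0%N / 2%:R.
  by move: (E 0%N 6%N 1%N isT isT isT); entry.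
have f53 : F 5%N 3%N = F 1%N 0%N / 2%:R.
  by move: (E 0%N 3%N 5%N isT isT isT); entry.
have f26 : F 2%N 6%N = F 4%N 0%N / 2%:R.
  by move: (E 0%N 6%N 2%N isT isT isT); entry.
have f63 : F 6%N 3%N = 0.
  by move: (E 0%N 3%N 6%N isT isT isT); entry.
have f36 : F 3%N 6%N = 0.
  by move: (E 0%N 6%N 3%N isT isT isT); entry.
have f44 : F 4%N 4%N = - F 1%N 1%N.
  by move: (E 1%N 2%N 6%N isT isT isT); move: (E 4%N 6%N 2%N isT isT isT); entry.
have f45 : F 4%N 5%N = - F 2%N 1%N.
  by move: (E 1%N 3%N 4%N isT isT isT); entry.
have f46 : F 4%N 6%N = - F 3%N 1%N.
  by move: (E 1%N 2%N 4%N isT isT isT); entry.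
have f54 : F 5%N 4%N = - F 1%N 2%N.
  by move: (E 2%N 3%N 5%N isT isT isT); entry.
have f55 : F 5%N 5%N = - F 2%N 2%N.
  by move: (E 1%N 2%N 6%N isT isT isT); move: (E 5%N 6%N 1%N isT isT isT); entry.
have f56 : F 5%N 6%N = - F 3%N 2%N.
  by move: (E 1%N 2%N 5%N isT isT isT); entry.
have f64 : F 6%N 4%N = - F 1%N 3%N.
  by move: (E 2%N 3%N 6%N isT isT isT); entry.
have f65 : F 6%N 5%N = - F 2%N 3%N.
  by move: (E 1%N 3%N 6%N isT isT isT); entry.
have f66 : F 6%N 6%N = - F 3%N 3%N.
  by move: (E 1%N 3%N 5%N isT isT isT); move: (E 5%N 6%N 1%N isT isT isT); entry.
have f33 : F 3%N 3%N = - F 1%N 1%N - F 2%N 2%N.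
  move: (E 1%N 2%N 6%N isT isT isT) (E 1%N 3%N 5%N isT isT isT).
  by move: (E 5%N 6%N 1%N isT isT isT); entry.
clear E d.
exists (F 1%N 0%N / 2%:R), (F 2%N 0%N / 2%:R), (F 3%N 0%N / 2%:R).
exists (F 4%N 0%N / 2%:R), (F 5%N 0%N / 2%:R), (F 6%N 0%N / 2%:R).
exists (F 1%N 1%N), (F 1%N 2%N), (F 1%N 3%N), (F 2%N 1%N), (F 2%N 2%N).
exists (F 2%N 3%N), (F 3%N 1%N), (F 3%N 2%N).
move=> i j; transitivity (F i j); first by rewrite /F !inord_val.
move: i j => [[|[|[|[|[|[|[|i]]]]]]] // _] [[|[|[|[|[|[|[|j]]]]]]] // _] /=;
  rewrite ?(f00, f01, f02, f03, f04, f05, f06, f14, f15, f16, f24, f25, f26)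
    ?(f34, f35, f36, f41, f42, f43, f51, f52, f53, f61, f62, f63)
    ?(f44, f45, f46, f54, f55, f56, f64, f65, f66, f33).
all: clear; by field.
Qed.

End imaginary_product.

(** * Trace identity and skewness of derivations *)

Section derivation_spectrum.
Context {R : realType}.
Implicit Types (A : 'M[R]_7).

(** The invariant polynomials of the Lie algebra of G_2 are generated in degrees 2 and 6, so the
    quartic invariant tr A^4 must be a multiple of (tr A^2)^2. The proof checks this as a polynomial
    identity in the 14 parameters; [S] spells out the sums over seven indices for [ring]. *)
Lemma im_derivation_trace A : im_derivation A ->
  (\tr (A *m A)) ^+ 2 = 4%:R * \tr ((A *m A) *m (A *m A)).
Proof.
case/im_derivation_rows=> p1 [p2 [p3 [q1 [q2 [q3 [m11 [m12 [m13 [m21 [m22 AE]]]]]]]]]].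
case: AE => m23 [m31 [m32 AE]].
set r := der_rows _ _ _ _ _ _ _ _ _ _ _ _ _ _ in AE.
pose S (f : nat -> R) := f 0%N + f 1%N + f 2%N + f 3%N + f 4%N + f 5%N + f 6%N.
have SE (f : nat -> R) : \sum_(i < 7) f i = S f.
  by rewrite !big_ord_recr big_ord0 /= add0r.
pose a i j := nth 0 (nth [::] r i) j.
pose b i j := S (fun k => a i k * a k j).
have AAE (i j : 'I_7) : (A *m A) i j = b i j.
  by rewrite mxE /b -SE; apply: eq_bigr => k _; rewrite !AE.
have -> : \tr (A *m A) = S (fun i => b i i).
  by rewrite -SE; apply: eq_bigr => i _; rewrite AAE.
have -> : \tr ((A *m A) *m (A *m A)) = S (fun i => S (fun j => b i j * b j i)).
  rewrite -SE; apply: eq_bigr => i _; rewrite -SE mxE.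
  by apply: eq_bigr => j _; rewrite !AAE.
by rewrite /b /S /a /r /=; ring.
Qed.

(* At c = 2, the matrix of the polar form of the quadratic form t^2 + u . v on
   the imaginary octonions ( t  u ; v  -t ). *)
Definition gram_rows (c : R) : seq (seq R) :=
  [:: [:: c; 0; 0; 0; 0; 0; 0];
      [:: 0; 0; 0; 0; 1; 0; 0];
      [:: 0; 0; 0; 0; 0; 1; 0];
      [:: 0; 0; 0; 0; 0; 0; 1];
      [:: 0; 1; 0; 0; 0; 0; 0];
      [:: 0; 0; 1; 0; 0; 0; 0];
      [:: 0; 0; 0; 1; 0; 0; 0]].

(** The norm form is preserved infinitesimally by derivations, with [G] its Gram matrix; as [G] is
    invertible, [A] is conjugate to [- A^T]. *)
Lemma im_derivation_skew A : im_derivation A ->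
  exists2 G : 'M[R]_7, G \in unitmx & G *m A = - (A^T *m G).
Proof.
case/im_derivation_rows=> p1 [p2 [p3 [q1 [q2 [q3 [m11 [m12 [m13 [m21 [m22 AE]]]]]]]]]].
case: AE => m23 [m31 [m32 AE]].
set r := der_rows _ _ _ _ _ _ _ _ _ _ _ _ _ _ in AE.
pose S (f : nat -> R) := f 0%N + f 1%N + f 2%N + f 3%N + f 4%N + f 5%N + f 6%N.
have SE (f : nat -> R) : \sum_(i < 7) f i = S f.
  by rewrite !big_ord_recr big_ord0 /= add0r.
pose g (c : R) i j := nth 0 (nth [::] (gram_rows c) i) j.
pose a i j := nth 0 (nth [::] r i) j.
pose G (c : R) : 'M[R]_7 := \matrix_(i, j) g c i j.
exists (G 2%:R).
  (* Apart from the corner entry the Gram matrix is an involution, so inverting the corner inverts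
     the matrix. *)
  have : G 2%:R *m G 2%:R^-1 = 1%:M.
    apply/matrixP => i j.
    transitivity (S (fun k => g 2%:R i k * g 2%:R^-1 k j)).
      by rewrite mxE -SE; apply: eq_bigr => k _; rewrite !mxE.
    rewrite mxE -val_eqE mulrb /S /g; case: i j =>
      [[|[|[|[|[|[|[|i]]]]]]] // _] [[|[|[|[|[|[|[|j]]]]]]] // _] /=; by field.
  by case/mulmx1_unit.
apply/matrixP => i j.
transitivity (S (fun k => g 2%:R i k * a k j)).
  by rewrite mxE -SE; apply: eq_bigr => k _; rewrite !mxE AE.
transitivity (- S (fun k => a k i * g 2%:R k j)); last first.
  by rewrite !mxE -SE; congr (- _); apply: eq_bigr => k _; rewrite !mxE AE.
rewrite /S /a /g /r; case: i j =>
  [[|[|[|[|[|[|[|i]]]]]]] // _] [[|[|[|[|[|[|[|j]]]]]]] // _] /=; ring.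
Qed.

End derivation_spectrum.

(** Similar matrices have the same characteristic polynomial, and its linear factors determine the
    diagonal up to order. *)
Lemma similar_diag_perm (F : fieldType) n (M : 'M[F]_n) (d d' : 'rV[F]_n) :
  M \in unitmx -> M *m diag_mx d = diag_mx d' *m M ->
  perm_eq [seq d 0 i | i <- enum 'I_n] [seq d' 0 i | i <- enum 'I_n].
Proof.
move=> uM MdM; apply: prod_XsubC_eq.
have charE (e : 'rV[F]_n) :
    \prod_(x <- [seq e 0 i | i <- enum 'I_n]) ('X - x%:P) = char_poly (diag_mx e).
  rewrite char_poly_trig ?diag_mx_is_trig// big_map big_enum /=.
  by apply: eq_bigr => i _; rewrite mxE eqxx.
rewrite !charE; pose MX := map_mx (@polyC F) M.
(* Cancelling the nonzero determinant of [M] over the polynomials avoids conjugating the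
   characteristic matrix by an inverse. *)
apply: (@mulfI _ (\det MX)).
  by rewrite det_map_mx polyC_eq0 -unitfE -unitmxE.
rewrite /char_poly -det_mulmx [RHS]mulrC -det_mulmx; congr (\det _).
rewrite /char_poly_mx mulmxBr mulmxBl; congr (_ - _).
  by rewrite scalar_mxC.
by rewrite -!map_mxM MdM.
Qed.

(** * From power sums to the weights of the standard representation *)

Section spectrum_shape.
Context {R : realType}.

Lemma G2_weights_of_power_sums (s : seq R) :
  size s = 7%N -> perm_eq s [seq - x | x <- s] ->
  (\sum_(x <- s) x ^+ 2) ^+ 2 = 4%:R * \sum_(x <- s) x ^+ 4 ->
  exists l1 l2 l3 : R,
    perm_eq s [:: 0; l1 - l2; - (l1 - l2); l1 - l3; - (l1 - l3);
                  l2 - l3; - (l2 - l3)].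
Proof.
pose t := sort >=%R s => s7 sN s24.
have st : perm_eq s t by rewrite perm_sym perm_sort.
have tsort : sorted >=%R t by apply: sort_sorted => x y; exact: le_total.
(* Both lists are decreasing with the same entries. Hence [t] reads a, b, c, 0, -c, -b, -a with a >=
   b >= c >= 0. *)
have tN : t = rev [seq - x | x <- t].
  apply: (@sorted_eq _ >=%R) => //.
  - by move=> x y z; rewrite /= => yx /le_trans; exact.
  - by move=> x y; rewrite andbC; exact: le_anti.
  - rewrite rev_sorted sorted_map; apply: sub_sorted tsort => x y /=.
    by rewrite lerN2.
  - rewrite perm_sym perm_rev.
    have := perm_map -%R st; rewrite perm_sym => /perm_trans; apply.
    by rewrite perm_sym in sN; exact: perm_trans sN st.
move: s24; rewrite !(perm_big _ st) /=.
have := size_sort >=%R s; rewrite -/t s7.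
case: t tsort tN st => [|a [|b [|c [|z [|c' [|b' [|a' [|]]]]]]]] //=.
rewrite /rev /= => /and5P[ba cb zc _ _] [_ _ _ zE c'E b'E a'E].
rewrite {}a'E {}b'E {}c'E in zE * => st _.
have {}zE : z = 0 by lra.
rewrite {}zE in zc st * => pow.
(* This is Heron's product: four times it is the difference of the two sides of [pow]. *)
have /eqP : (a + b + c) * (a + b - c) * (a - b + c) * (b + c - a) = 0.
  apply: (@mulfI _ 4%:R); first by rewrite pnatr_eq0.
  rewrite mulr0 -[RHS](subrr
    (4%:R * \sum_(i <- [:: a; b; c; 0; - c; - b; - a]) i ^+ 4)).
  by rewrite -{1}pow !big_cons !big_nil; ring.
rewrite !mulf_eq0 => prod0.
(* By the ordering of a, b and c, the vanishing of any of the first three factors forces a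
   degenerate case of the same equation. *)
have abc : a = b + c.
  by case/orP: prod0 => [/orP[/orP[]|]|] /eqP ?; lra.
(* The three differences are then a - c = b, a and c. *)
exists a, c, 0; apply: (perm_trans st).
have -> : a - c = b by rewrite abc addrK.
by rewrite !subr0; apply/permP => p /=; ring.
Qed.

Lemma im_derivation_spectrum (A Q : 'M[R]_7) (d : 'rV[R]_7) :
  im_derivation A -> Q \in unitmx -> A *m Q = Q *m diag_mx d ->
  exists l1 l2 l3 : R, perm_eq [seq d 0 i | i <- enum 'I_7]
    [:: 0; l1 - l2; - (l1 - l2); l1 - l3; - (l1 - l3); l2 - l3; - (l2 - l3)].
Proof.
move=> derA uQ AQ; apply: G2_weights_of_power_sums.
- by rewrite size_map size_enum_ord.
- have [G uG GA] := im_derivation_skew derA.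
  have -> : [seq - x | x <- [seq d 0 i | i <- enum 'I_7]] =
      [seq (- d) 0 i | i <- enum 'I_7].
    by rewrite -map_comp; apply: eq_map => i; rewrite /= mxE.
  (* The Gram matrix in the eigenbasis intertwines [diag_mx d] with its opposite. *)
  apply: (@similar_diag_perm _ _ (Q^T *m G *m Q)).
    by rewrite !unitmx_mul unitmx_tr uQ uG.
  transitivity (Q^T *m (G *m A) *m Q); first by rewrite -!mulmxA AQ.
  rewrite GA mulmxN mulmxA -trmx_mul AQ trmx_mul tr_diag_mx.
  by rewrite linearN /= !mulNmx !mulmxA.
- have tr_conj (M : 'M[R]_7) (e : 'rV[R]_7) : M *m Q = Q *m diag_mx e ->
      \tr M = \sum_i e 0 i.
    move=> MQ; rewrite -mxtrace_diag -[M](mulmxK uQ) MQ mxtrace_mulC mulmxA.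
    by rewrite mulVmx ?mul1mx.
  pose d2 : 'rV[R]_7 := \row_i (d 0 i ^+ 2).
  pose d4 : 'rV[R]_7 := \row_i (d 0 i ^+ 4).
  have AAQ : A *m A *m Q = Q *m diag_mx d2.
    by rewrite -mulmxA AQ mulmxA AQ -mulmxA mulmx_diag.
  have AAAAQ : A *m A *m (A *m A) *m Q = Q *m diag_mx d4.
    rewrite -mulmxA AAQ mulmxA AAQ -mulmxA mulmx_diag; congr (_ *m diag_mx _).
    by apply/rowP => i; rewrite !mxE -exprD.
  have sumE k :
      \sum_(x <- [seq d 0 i | i <- enum 'I_7]) x ^+ k = \sum_i d 0 i ^+ k.
    by rewrite big_map big_enum.
  have := im_derivation_trace derA.
  rewrite (tr_conj _ _ AAQ) (tr_conj _ _ AAAAQ) !sumE.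
  rewrite (eq_bigr _ (fun i _ => mxE _ _ _ _)).
  by rewrite [\sum_i d4 0 i](eq_bigr _ (fun i _ => mxE _ _ _ _)).
Qed.

End spectrum_shape.

(** * Exponential growth rates *)

Section growth.
Context {R : realType}.
Implicit Types (f g : R -> R) (a b c e : R).

(** The arbitrarily small loss [e] in the rate absorbs constant factors and finite sums. Only the
    limit at +oo is considered; negative times are treated by reversing time. *)
Definition rate_le f a :=
  forall e, 0 < e -> \forall t \near +oo, f t <= expR ((a + e) * t).

Definition rate_ge f a :=
  forall e, 0 < e -> \forall t \near +oo, expR ((a - e) * t) <= f t.

Lemma log_rate f a : (forall t, 0 < f t) -> ln (f t) / t @[t --> +oo] --> a ->
  rate_le f a /\ rate_ge f a.
Proof.
move=> f0 fa; split=> e e0.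
  near=> t; have t0 : 0 < t by near: t; exact: nbhs_pinfty_gt.
  rewrite -[leLHS]lnK ?posrE// ler_expR -ler_pdivrMr//.
  by apply: ltW; near: t; apply: cvgr_lt fa _ _; rewrite ltrDl.
near=> t; have t0 : 0 < t by near: t; exact: nbhs_pinfty_gt.
rewrite -[leRHS]lnK ?posrE// ler_expR -ler_pdivlMr//.
by apply: ltW; near: t; apply: cvgr_gt fa _ _; rewrite ltrBlDr ltrDl.
Unshelve. all: by end_near. Qed.

Lemma rate_leM f g a b : (forall t, 0 <= f t) -> (forall t, 0 <= g t) ->
  rate_le f a -> rate_le g b -> rate_le (fun t => f t * g t) (a + b).
Proof.
move=> f0 g0 fa gb e e0; have e2 : 0 < e / 2 by rewrite divr_gt0.
near=> t; have -> : (a + b + e) * t = (a + e / 2) * t + (b + e / 2) * t by field.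
rewrite expRD; apply: ler_pM => //; near: t; [exact: (fa _ e2)|exact: (gb _ e2)].
Unshelve. all: by end_near. Qed.

Lemma expR_near_ge c e : 0 < e -> \forall t \near +oo, c <= expR (e * t).
Proof.
move=> e0; near=> t; apply: le_trans (expR_ge1Dx _).
have : c / e <= t by near: t; apply: nbhs_pinfty_ge; exact: num_real.
rewrite ler_pdivrMr// mulrC => /le_trans; apply.
by rewrite lerDr.
Unshelve. all: by end_near. Qed.

Lemma rate_le_cst c : rate_le (cst c) 0.
Proof.
move=> e e0; near=> t; rewrite add0r /cst; near: t; exact: expR_near_ge.
Unshelve. all: by end_near. Qed.

Lemma rate_leS a b f : a <= b -> rate_le f a -> rate_le f b.
Proof.
move=> ab fa e e0; near=> t; have t0 : 0 < t by near: t; exact: nbhs_pinfty_gt.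
apply: (@le_trans _ _ (expR ((a + e) * t))); first by near: t; exact: (fa _ e0).
by rewrite ler_expR ler_pM2r// lerD2r.
Unshelve. all: by end_near. Qed.

Lemma rate_leD f g a : rate_le f a -> rate_le g a ->
  rate_le (fun t => f t + g t) a.
Proof.
move=> fa ga e e0; have e2 : 0 < e / 2 by rewrite divr_gt0.
near=> t; have -> : (a + e) * t = (e / 2) * t + (a + e / 2) * t by field.
rewrite expRD; apply: (@le_trans _ _ (2 * expR ((a + e / 2) * t))).
  rewrite mulr_natl mulr2n.
  by apply: lerD; near: t; [exact: (fa _ e2)|exact: (ga _ e2)].
by rewrite ler_pM2r ?expR_gt0//; near: t; exact: expR_near_ge.
Unshelve. all: by end_near. Qed.

Lemma rate_le_sum (I : Type) (r : seq I) (P : pred I) (F : I -> R -> R) a :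
  (forall i, P i -> rate_le (F i) a) ->
  rate_le (fun t => \sum_(i <- r | P i) F i t) a.
Proof.
move=> Fa; elim: r => [|i r IH].
  move=> e e0; near=> t; rewrite big_nil; exact: expR_ge0.
have [Pi|Pi] := boolP (P i).
  under eq_fun do rewrite big_cons Pi.
  by apply: rate_leD => //; exact: Fa.
by under eq_fun do rewrite big_cons (negbTE Pi).
Unshelve. all: by end_near. Qed.

(** Both exponential bounds hold eventually, so comparing [f] and [g] at arbitrarily large times is
    enough. Recurrence provides no more than such times. *)
Lemma rate_compare f g a b : rate_ge f a -> rate_le g b ->
  (forall T, exists2 t, T < t & f t <= g t) -> a <= b.
Proof.
move=> fa gb fg; rewrite leNgt; apply/negP => ba.
(* With a third of the gap as loss, the two perturbed rates remain strictly ordered. *)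
have e0 : 0 < (a - b) / 3%:R by rewrite divr_gt0// subr_gt0.
have [M [Mr MP]] : \forall t \near +oo, [/\ 0 < t,
    expR ((a - (a - b) / 3%:R) * t) <= f t &
    g t <= expR ((b + (a - b) / 3%:R) * t)].
  near=> t; split; near: t; first exact: nbhs_pinfty_gt.
    exact: (fa _ e0).
  exact: (gb _ e0).
have [t Mt ftgt] := fg M.
have [t0 ft gt] := MP _ Mt.
have := le_trans ft (le_trans ftgt gt).
rewrite ler_expR ler_pM2r// leNgt => /negP; apply; lra.
Unshelve. all: by end_near. Qed.

End growth.

(** * Seminorms on column vectors *)

Section seminorms.
Context {R : realType} {k : nat}.
Implicit Types (n : 'cV[R]_k -> R) (v w : 'cV[R]_k).

Record is_seminorm n : Prop := IsSeminorm {
  seminormD : forall v w, n (v + w) <= n v + n w ;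
  seminormZ : forall r v, n (r *: v) = `|r| * n v }.

Record is_norm n : Prop := IsNorm {
  norm_is_seminorm : is_seminorm n ;
  norm_eq0 : forall v, n v = 0 -> v = 0 }.

Lemma seminorm0 n : is_seminorm n -> n 0 = 0.
Proof. by case=> _ nZ; rewrite -(scale0r 0) nZ normr0 mul0r. Qed.

Lemma seminormN n v : is_seminorm n -> n (- v) = n v.
Proof. by case=> _ nZ; rewrite -scaleN1r nZ normrN1 mul1r. Qed.

Lemma seminorm_ge0 n v : is_seminorm n -> 0 <= n v.
Proof.
move=> sn; have := seminormD sn v (- v).
by rewrite subrr seminorm0// seminormN// -mulr2n pmulrn_lge0.
Qed.

Lemma seminorm_sum n (I : Type) (r : seq I) (P : pred I) (F : I -> 'cV[R]_k) :
  is_seminorm n -> n (\sum_(i <- r | P i) F i) <= \sum_(i <- r | P i) n (F i).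
Proof.
move=> sn; elim/big_rec2: _ => [|i a b _ ba]; first by rewrite seminorm0.
by apply: le_trans (seminormD sn _ _) _; rewrite lerD2l.
Qed.

Lemma norm_gt0 n v : is_norm n -> v != 0 -> 0 < n v.
Proof.
move=> [sn n0] v0; rewrite lt_def seminorm_ge0// andbT.
by apply: contra_neq v0; exact: n0.
Qed.

End seminorms.

Lemma mulmx_col (F : pzSemiRingType) m n p (A : 'M[F]_(m, n))
    (B : 'M[F]_(n, p)) j :
  A *m col j B = col j (A *m B).
Proof. by rewrite !colE mulmxA. Qed.

Lemma mulmx_sum_col (F : comPzRingType) m n (A : 'M[F]_(m, n)) (c : 'cV[F]_n) :
  A *m c = \sum_j c j 0 *: col j A.
Proof.
apply/colP => i; rewrite summxE mxE; apply: eq_bigr => j _.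
by rewrite !mxE mulrC.
Qed.

Lemma col_unitmx_neq0 (F : comUnitRingType) n (Q : 'M[F]_n) j :
  Q \in unitmx -> col j Q != 0.
Proof.
move=> uQ; apply/eqP => /(congr1 (mulmx (invmx Q))).
move=> /(congr1 (fun v : 'cV_n => v j 0)).
by rewrite mulmx_col mulVmx// mulmx0 !mxE eqxx => /eqP; rewrite oner_eq0.
Qed.

Lemma eigen_colP (F : comPzRingType) n (A Q : 'M[F]_n) (d : 'rV[F]_n) :
  A *m Q = Q *m diag_mx d <-> forall j, A *m col j Q = d 0 j *: col j Q.
Proof.
have colQd j : col j (Q *m diag_mx d) = d 0 j *: col j Q.
  by rewrite mul_mx_diag; apply/colP => i; rewrite !mxE mulrC.
split=> [AQ j|Acol]; first by rewrite mulmx_col AQ.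
apply/matrixP => i j; have := congr1 (fun v : 'cV_n => v i 0) (Acol j).
by rewrite mulmx_col -colQd mxE [RHS]mxE.
Qed.

(** * Growth rates as eigenvalues of an operator *)

Section exponential_growth.
Context {R : realType} {k : nat}.
Implicit Types (n : R -> 'cV[R]_k -> R) (A Q : 'M[R]_k) (d : 'rV[R]_k).

(** A splitting is encoded by a diagonalizable [A]: its eigenspaces are the Oseledets spaces and its
    eigenvalues the exponents. *)
Definition exp_growth n A := forall c v, v != 0 -> A *m v = c *: v ->
  ln (n t v) / t @[t --> +oo] --> c.

(* The components of w of maximal exponent dominate all others. *)
Lemma growth_component_le n A Q d w F c :
  (forall t, is_norm (n t)) -> Q \in unitmx -> A *m Q = Q *m diag_mx d ->
  exp_growth n A -> rate_le F c -> (forall T, exists2 t, T < t & n t w <= F t) ->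
  forall j, (invmx Q *m w) j 0 != 0 -> d 0 j <= c.
Proof.
move=> nn uQ AQ gn Fc wF j cj.
pose x := invmx Q *m w.
have rate v b : v != 0 -> A *m v = b *: v ->
    rate_le (n^~ v) b /\ rate_ge (n^~ v) b.
  by move=> v0 Av; apply: log_rate => [t|]; [exact: norm_gt0|exact: gn].
have Acol := (eigen_colP A Q d).1 AQ.
have col0 i := col_unitmx_neq0 i uQ.
pose i0 := [arg max_(i > j | x i 0 != 0) d 0 i]%O.
have [xi0 i0max] : x i0 0 != 0 /\ forall i, x i 0 != 0 -> d 0 i <= d 0 i0.
  by rewrite /i0; case: arg_maxP => // i xi imax; split.
apply: (le_trans (i0max _ cj)).
rewrite leNgt; apply/negP => ci0.
(* The part [top] of maximal exponent is an eigenvector of [A], hence its growth rate is known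
   exactly. *)
pose low := \sum_(i | (x i 0 != 0) && (d 0 i != d 0 i0)) x i 0 *: col i Q.
pose top := \sum_(i | (x i 0 != 0) && (d 0 i == d 0 i0)) x i 0 *: col i Q.
have wE : w = top + low.
  rewrite -[LHS](mulKVmx uQ) mulmx_sum_col (bigID (fun i => x i 0 != 0)) /=.
  rewrite [X in _ + X]big1 ?addr0 => [|i]; last first.
    by rewrite negbK => /eqP xi; rewrite -/x xi scale0r.
  by rewrite (bigID (fun i => d 0 i == d 0 i0)).
have Atop : A *m top = d 0 i0 *: top.
  rewrite mulmx_sumr scaler_sumr; apply: eq_bigr => i /andP[_ /eqP di].
  by rewrite -scalemxAr Acol di !scalerA mulrC.
have top0 : top != 0.
  apply/eqP => top0; move/eqP: (xi0); apply.
  move: (congr1 (fun v => (invmx Q *m v) i0 0) top0).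
  rewrite /= mulmx0 mulmx_sumr summxE (bigD1 i0) /=; last by rewrite xi0 eqxx.
  rewrite big1 ?addr0 => [|i].
    by rewrite -scalemxAr mulmx_col mulVmx// !mxE eqxx mulr1.
  case/andP=> _ ii0.
  by rewrite -scalemxAr mulmx_col mulVmx// !mxE eq_sym (negbTE ii0) mulr0.
(* The default value [c] makes [b] bound the rate of [F] as well as those in [low], while staying
   below the maximal exponent. *)
pose b := \big[Num.max/c]_(i | (x i 0 != 0) && (d 0 i != d 0 i0)) d 0 i.
have bi0 : b < d 0 i0.
  apply/bigmax_ltP; split=> // i /andP[xi di].
  by rewrite lt_neqAle di i0max.
have cb : c <= b by exact: bigmax_ge_id.
have [_ rtop] := rate _ _ top0 Atop.
have : d 0 i0 <= b; last by rewrite leNgt bi0.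
pose Fl t := \sum_(i | (x i 0 != 0) && (d 0 i != d 0 i0)) `|x i 0| * n t (col i Q).
apply: (@rate_compare _ (n^~ top) (fun t => F t + Fl t)) => //.
- apply: rate_leD; first exact: rate_leS Fc.
  apply: rate_le_sum => i Pi.
  rewrite -[b]add0r; apply: rate_leM => [t|t||]; first exact: normr_ge0.
  + exact/seminorm_ge0/norm_is_seminorm.
  + exact: rate_le_cst.
  + have [ri _] := rate _ _ (col0 i) (Acol i).
    by apply: rate_leS ri; rewrite /b; exact: le_bigmax_cond.
- move=> T; have [t Tt wt] := wF T; exists t => //.
  have sn := norm_is_seminorm (nn t).
  have -> : top = w - low by rewrite wE addrK.
  apply: le_trans (seminormD sn _ _) _; rewrite seminormN//; apply: lerD => //.
  apply: le_trans (seminorm_sum _ _ _ sn) _.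
  by apply: ler_sum => i _; rewrite (seminormZ sn).
Qed.

(** The bound in positive time excludes components of exponent above [c], and the bound in negative
    time those of exponent below [c]. *)
Lemma growth_eigen n A Q d w F Fneg c :
  (forall t, is_norm (n t)) -> Q \in unitmx -> A *m Q = Q *m diag_mx d ->
  exp_growth n A -> exp_growth (fun t => n (- t)) (- A) ->
  rate_le F c -> rate_le Fneg (- c) ->
  (forall T, exists2 t, T < t & n t w <= F t) ->
  (forall T, exists2 t, T < t & n (- t) w <= Fneg t) ->
  A *m w = c *: w.
Proof.
move=> nn uQ AQ gp gm Fc Fc' wp wm.
have AQ' : - A *m Q = Q *m diag_mx (- d).
  by rewrite mulNmx AQ linearN /= mulmxN.
have up := growth_component_le nn uQ AQ gp Fc wp.
have dn := growth_component_le (fun t => nn (- t)) uQ AQ' gm Fc' wm.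
set x := invmx Q *m w in up dn.
have -> : w = Q *m x by rewrite mulKVmx.
rewrite mulmxA AQ -mulmxA scalemxAr; congr (_ *m _).
apply/colP => j; rewrite mul_diag_mx mxE [RHS]mxE.
have [->|xj] := eqVneq (x j 0) 0; first by rewrite !mulr0.
congr (_ * _); apply/eqP; rewrite eq_le up//=.
by have := dn _ xj; rewrite mxE lerN2.
Qed.

End exponential_growth.

(** * Bilinearity of the product *)

Section im_mul_bilinear.
Context {R : realType}.
Implicit Types (v w : 'cV[R]_7).

Lemma im_mulDZl w : linear (im_mul^~ w).
Proof.
move=> r v v'; apply/colP => i; rewrite [RHS]mxE [X in _ = X + _]mxE !im_mulE.
case: i => h; move: h => [|[|[|[|[|[|[|h]]]]]]] // _ /=; rewrite !mxE; by field.
Qed.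

Lemma im_mulDZr v : linear (im_mul v).
Proof.
move=> r w w'; apply/colP => i; rewrite [RHS]mxE [X in _ = X + _]mxE !im_mulE.
case: i => h; move: h => [|[|[|[|[|[|[|h]]]]]]] // _ /=; rewrite !mxE; by field.
Qed.

HB.instance Definition _ v :=
  GRing.isLinear.Build R 'cV[R]_7 'cV[R]_7 *:%R (im_mul v) (im_mulDZr v).

(** The swapped arguments let this function carry the linear structure in the first factor. *)
Definition im_mulr w v := im_mul v w.

HB.instance Definition _ w :=
  GRing.isLinear.Build R 'cV[R]_7 'cV[R]_7 *:%R (im_mulr w) (im_mulDZl w).

Lemma linear_eq_basis (f g : {linear 'cV[R]_7 -> 'cV[R]_7}) (Q : 'M[R]_7) :
  Q \in unitmx -> (forall i, f (col i Q) = g (col i Q)) -> f =1 g.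
Proof.
move=> uQ fg v; rewrite -[v](mulKVmx uQ) mulmx_sum_col !linear_sum.
by apply: eq_bigr => i _; rewrite !linearZ /= fg.
Qed.

(** Both sides of the Leibniz rule are bilinear, so an eigenbasis of [A] suffices to test it. *)
Lemma im_derivation_basis (A Q : 'M[R]_7) (d : 'rV[R]_7) :
  Q \in unitmx -> A *m Q = Q *m diag_mx d ->
  (forall i j, A *m im_mul (col i Q) (col j Q) =
     (d 0 i + d 0 j) *: im_mul (col i Q) (col j Q)) ->
  im_derivation A.
Proof.
move=> uQ AQ Ader v w.
have Acol := (eigen_colP A Q d).1 AQ.
pose f w' : {linear 'cV[R]_7 -> 'cV[R]_7} := mulmx A \o im_mulr w'.
pose g w' : {linear 'cV[R]_7 -> 'cV[R]_7} :=
  (im_mulr w' \o mulmx A) \+ im_mulr (A *m w').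
apply: (@linear_eq_basis (f w) (g w) Q uQ) => i.
pose f' : {linear 'cV[R]_7 -> 'cV[R]_7} := mulmx A \o im_mul (col i Q).
pose g' : {linear 'cV[R]_7 -> 'cV[R]_7} :=
  im_mul (A *m col i Q) \+ (im_mul (col i Q) \o mulmx A).
apply: (@linear_eq_basis f' g' Q uQ) => j.
rewrite /f' /g' /= Ader !Acol -/(im_mulr (col j Q) (_ *: _)) !linearZ /=.
by rewrite -scalerDl.
Qed.

End im_mul_bilinear.

(** * Growth of products and uniqueness of the spectrum *)

Section growth_derivation.
Context {R : realType}.
Implicit Types (n : R -> 'cV[R]_7 -> R) (A Q : 'M[R]_7) (d : 'rV[R]_7).

Definition exp_growth2 n A := forall c v, v != 0 -> A *m v = c *: v ->
  (ln (n t v) / t @[t --> +oo] --> c) /\ (ln (n t v) / t @[t --> -oo] --> c).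

Lemma exp_growth2_pos n A : exp_growth2 n A -> exp_growth n A.
Proof. by move=> g c v v0 Av; have [] := g c v v0 Av. Qed.

(** Reversing time changes the sign of every exponent. *)
Lemma exp_growth2_neg n A :
  exp_growth2 n A -> exp_growth (fun t => n (- t)) (- A).
Proof.
move=> g c v v0 Av; have /(g _ _ v0)[_ /cvgNy_compNP] : A *m v = - c *: v.
  by rewrite -[A]opprK mulNmx Av scaleNr.
move=> /cvgN; rewrite opprK => gN.
suff -> : (fun t => ln (n (- t) v) / t) = - ((fun t => ln (n t v) / t) \o -%R) by [].
by apply/funext => t; rewrite fctE /= invrN mulrN opprK.
Qed.

Lemma exp_growth_rate_le n A v c : (forall t, is_norm (n t)) ->
  exp_growth n A -> v != 0 -> A *m v = c *: v -> rate_le (n^~ v) c.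
Proof.
move=> nn g v0 Av.
by have [] := log_rate (fun t => norm_gt0 (nn t) v0) (g _ _ v0 Av).
Qed.

Definition im_mul_bounded (n : 'cV[R]_7 -> R) (K : R) :=
  forall v w, n (im_mul v w) <= K * (n v * n w).

(** At the good times a product of eigenvectors is bounded by the product of their norms, whose rate
    is the sum of the exponents, in both time directions. By [growth_eigen] the product is zero or
    an eigenvector for that sum. *)
Lemma growth_im_derivation n A Q d (K : R) :
  (forall t, is_norm (n t)) -> Q \in unitmx -> A *m Q = Q *m diag_mx d ->
  exp_growth2 n A ->
  (forall T, exists2 t, T < t & im_mul_bounded (n t) K) ->
  (forall T, exists2 t, T < t & im_mul_bounded (n (- t)) K) ->
  im_derivation A.
Proof.
move=> nn uQ AQ g Kp Kn; apply: (im_derivation_basis uQ AQ) => i j.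
have n0 t v : 0 <= n t v by exact/seminorm_ge0/norm_is_seminorm.
have Acol := (eigen_colP A Q d).1 AQ.
have ANcol h : - A *m col h Q = (- d 0 h) *: col h Q.
  by rewrite mulNmx Acol scaleNr.
(* [K] comes without a sign, while rates are multiplied for nonnegative functions. *)
have K0 : 0 <= `|K| by [].
have rp h :=
  exp_growth_rate_le nn (exp_growth2_pos g) (col_unitmx_neq0 h uQ) (Acol h).
have rn h := exp_growth_rate_le (fun t => nn (- t)) (exp_growth2_neg g)
  (col_unitmx_neq0 h uQ) (ANcol h).
apply: (growth_eigen nn uQ AQ (exp_growth2_pos g) (exp_growth2_neg g)
  (F := fun t => `|K| * (n t (col i Q) * n t (col j Q)))
  (Fneg := fun t => `|K| * (n (- t) (col i Q) * n (- t) (col j Q)))).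
- rewrite -[d 0 i + _]add0r; apply: (@rate_leM _ (cst `|K|)) => //.
  + by move=> t; rewrite mulr_ge0.
  + exact: rate_le_cst.
  + exact: rate_leM.
- rewrite opprD -[- _ - _]add0r; apply: (@rate_leM _ (cst `|K|)) => //.
  + by move=> t; rewrite mulr_ge0.
  + exact: rate_le_cst.
  + exact: rate_leM.
- move=> T; have [t Tt Kt] := Kp T; exists t => //.
  by rewrite (le_trans (Kt _ _))// ler_wpM2r ?mulr_ge0// ler_norm.
- move=> T; have [t Tt Kt] := Kn T; exists t => //.
  by rewrite (le_trans (Kt _ _))// ler_wpM2r ?mulr_ge0// ler_norm.
Qed.

(** The growth of a column of [Q'] at both ends makes it an eigenvector of [A] with the same
    eigenvalue. Thus [Q'] diagonalizes [A] too, and the two diagonal matrices are similar. *)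
Lemma growth_spectrum_unique n A Q d A' Q' d' : (forall t, is_norm (n t)) ->
  Q \in unitmx -> A *m Q = Q *m diag_mx d -> exp_growth2 n A ->
  Q' \in unitmx -> A' *m Q' = Q' *m diag_mx d' -> exp_growth2 n A' ->
  perm_eq [seq d 0 i | i <- enum 'I_7] [seq d' 0 i | i <- enum 'I_7].
Proof.
move=> nn uQ AQ g uQ' AQ' g'.
have A'col := (eigen_colP A' Q' d').1 AQ'.
have A'Ncol h : - A' *m col h Q' = (- d' 0 h) *: col h Q'.
  by rewrite mulNmx A'col scaleNr.
have ltS (T : R) : T < T + 1 by rewrite ltrDl.
have Acol h : A *m col h Q' = d' 0 h *: col h Q'.
  apply: (growth_eigen nn uQ AQ (exp_growth2_pos g) (exp_growth2_neg g)
    (F := n^~ (col h Q')) (Fneg := fun t => n (- t) (col h Q'))).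
  - exact: exp_growth_rate_le (exp_growth2_pos g') (col_unitmx_neq0 _ _) _.
  - exact: (exp_growth_rate_le (fun t => nn (- t)) (exp_growth2_neg g')
      (col_unitmx_neq0 _ uQ') (A'Ncol h)).
  - by move=> T; exists (T + 1).
  - by move=> T; exists (T + 1).
have AQ'E := (eigen_colP A Q' d').2 Acol.
rewrite perm_sym; apply: (@similar_diag_perm _ _ (invmx Q *m Q')).
  by rewrite unitmx_mul unitmx_inv uQ.
rewrite -mulmxA -AQ'E -[A](mulmxK uQ) AQ.
by rewrite !mulmxA mulVmx// mul1mx.
Qed.

End growth_derivation.

(** * Comparison of seminorms in finite dimension *)

Section seminorm_comparison.
Context {R : realType}.

Lemma seminorm_le_coords k (s : 'cV[R]_k -> R) (v : 'cV[R]_k) e : is_seminorm s ->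
  (forall i, `|v i 0| <= e) -> s v <= e * \sum_i s (delta_mx i 0).
Proof.
move=> ss ve; rewrite {1}[v]matrix_sum_delta.
apply: le_trans (seminorm_sum _ _ _ ss) _; rewrite mulr_sumr.
apply: ler_sum => i _; rewrite big_ord1 (seminormZ ss).
by rewrite ler_wpM2r// seminorm_ge0.
Qed.

(** Rational vectors are dense and seminorms are Lipschitz. This turns a bound on all vectors into
    countably many inequalities, as measurability requires. *)
Lemma seminorm_le_rat k (s s' : 'cV[R]_k -> R) :
  is_seminorm s -> is_seminorm s' ->
  (forall w : 'cV[rat]_k, s (map_mx ratr w) <= s' (map_mx ratr w)) ->
  forall v, s v <= s' v.
Proof.
move=> ss ss' ratss' v; pose C n := \sum_i n (delta_mx i 0 : 'cV[R]_k) : R.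
have C0 n : is_seminorm n -> 0 <= C n.
  by move=> sn; apply: sumr_ge0 => i _; exact: seminorm_ge0.
have D0 : 0 < C s + C s' + 1 by rewrite ltr_pwDr// addr_ge0// C0.
apply/ler_addgt0Pr => _/posnumP[e].
(* The approximation error costs at most [d * (C s + C s')]; the summand 1 keeps the denominator
   positive. *)
pose d := e%:num / (C s + C s' + 1).
have d0 : 0 < d by rewrite divr_gt0.
have /choice[q qP] (i : 'I_k) : exists q : rat, `|v i 0 - ratr q| <= d.
  have /rat_in_itvoo[q /itvP qre] : v i 0 < v i 0 + d by rewrite ltrDl.
  exists q; rewrite distrC ltW// ltr_distl qre andbT.
  by rewrite (@le_lt_trans _ _ (v i 0)) ?qre// lerBlDl lerDr ltW.
pose w : 'cV[rat]_k := \col_i q i.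
have uP i : `|(v - map_mx ratr w) i 0| <= d by rewrite !mxE.
have -> : s v = s (map_mx ratr w + (v - map_mx ratr w)) by rewrite addrC subrK.
apply: le_trans (seminormD ss _ _) _.
have : s' (map_mx ratr w) <= s' v + s' (v - map_mx ratr w).
  have {1}-> : map_mx ratr w = v - (v - map_mx ratr w) by rewrite subKr.
  by apply: le_trans (seminormD ss' _ _) _; rewrite (seminormN _ ss').
have := ratss' w; have := seminorm_le_coords ss uP.
have := seminorm_le_coords ss' uP; rewrite -/(C s) -/(C s').
have : d * C s + d * C s' <= e%:num.
  rewrite -mulrDr /d mulrAC ler_pdivrMr// ler_pM2l// lerDl ler01.
  by [].
lra.
Qed.

Lemma seminorm_continuous k (s : 'rV[R]_k -> R) (s' : 'cV[R]_k -> R) :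
  is_seminorm s' -> (forall v, s v = s' v^T) -> continuous s.
Proof.
move=> ss' sE v; apply/(@cvgrPdist_le _ _ _ (nbhs v) (nbhs_filter v)) => e e0.
pose C := \sum_i s' (delta_mx i 0 : 'cV[R]_k) : R.
have C0 : 0 < C + 1.
  by rewrite ltr_pwDr// sumr_ge0// => i _; exact: seminorm_ge0.
near=> w.
have vw : `|v - w| <= e / (C + 1).
  near: w; apply/nbhs_ballP; exists (e / (C + 1)); first exact: divr_gt0.
  by move=> w; rewrite mx_norm_ball; exact: ltW.
have vwT i : `|(v - w)^T i 0| <= e / (C + 1).
  rewrite mxE; apply: le_trans vw.
  rewrite [leRHS]/Num.norm /= mx_normrE; apply/bigmax_geP; right => /=.
  by exists (0, i).
have bnd : s' (v - w)^T <= e.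
  apply: le_trans (seminorm_le_coords ss' vwT) _.
  by rewrite mulrAC ler_pdivrMr// ler_pM2l// lerDl.
rewrite !sE; apply: le_trans bnd; rewrite ler_distl linearB /=.
have := seminormD ss' (v^T - w^T) w^T; rewrite subrK.
have := seminormD ss' (w^T - v^T) v^T; rewrite subrK.
rewrite -[w^T - v^T]opprB seminormN//.
lra.
Unshelve. all: by end_near. Qed.

(** The norm [n] has a positive minimum on the compact unit sphere of the sup norm, and [s] is
    bounded there; homogeneity does the rest. *)
Lemma seminorm_le_norm k (s n : 'cV[R]_k -> R) : is_seminorm s -> is_norm n ->
  exists2 K, 0 <= K & forall v, s v <= K * n v.
Proof.
(* In dimension 0 the unit sphere is empty. *)
case: k s n => [|k] s n ss nn.
  by exists 0 => // v; rewrite flatmx0 seminorm0// mul0r.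
have sn := norm_is_seminorm nn.
pose S := [set v : 'rV[R]_k.+1 | `|v| = 1].
have S0 : S !=set0.
  exists (const_mx 1); rewrite /S /= [LHS]/Num.norm /= mx_normrE.
  apply/eqP; rewrite eq_le; apply/andP; split.
    by apply/bigmax_leP; split=> // i _; rewrite mxE normr1.
  by apply/bigmax_geP; right; exists (0, 0) => //; rewrite mxE normr1.
have cS : compact S.
  apply: bounded_closed_compact.
    by exists 1; split=> // M M1 v /= ->; exact: ltW.
  have -> : S = (@Num.norm R _) @^-1` [set 1] by [].
  by apply: closed_comp; [move=> v _; exact: norm_continuous|exact: closed_eq].
have cn : continuous (fun v : 'rV[R]_k.+1 => n v^T).
  exact: (@seminorm_continuous _ _ n).
have [v0 v0S v0min] := EVT_min_rV S0 cS (continuous_subspaceT cn).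
have nv0 : 0 < n v0^T.
  apply: norm_gt0 => //; apply: contraTneq v0S => v00.
  rewrite notin_setE /S /= -[v0]trmxK v00 trmx0 normr0.
  by apply/eqP; rewrite eq_sym oner_eq0.
pose C := \sum_i s (delta_mx i 0 : 'cV[R]_k.+1) : R.
have C0 : 0 <= C by apply: sumr_ge0 => i _; exact: seminorm_ge0.
exists (C / n v0^T) => [|v]; first by rewrite divr_ge0// ltW.
have [->|vneq0] := eqVneq v 0; first by rewrite !seminorm0// mulr0.
have vT0 : 0 < `|v^T| by rewrite normr_gt0 -trmx0 (can_eq (@trmxK _ _ _)).
have sv : s v <= `|v^T| * C.
  apply: seminorm_le_coords => // i.
  rewrite [leRHS]/Num.norm /= mx_normrE; apply/bigmax_geP; right => /=.
  by exists (0, i) => //; rewrite mxE.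
have nv : n v0^T * `|v^T| <= n v.
  have : `|v^T|^-1 *: v^T \in S.
    by rewrite inE /S /= normrZ normfV normr_id mulVf// gt_eqF.
  move/v0min; rewrite linearZ /= trmxK (seminormZ sn) normfV normr_id.
  by rewrite ler_pdivlMl// mulrC.
apply: le_trans sv _; rewrite mulrC -mulrA ler_wpM2l//.
by rewrite ler_pdivlMl.
Qed.

End seminorm_comparison.

(** * Recurrence and bounded products *)

(** The set [B m] of points that visit [A] at some time at least [m] decreases with [m], and its
    preimage under [T] is [B m.+1]. All the [B m] thus have the same finite measure, and their
    successive differences are null. *)
Lemma poincare_recurrence (R : realType) d (X : measurableType d)
    (mu : probability X R) (T : X -> X) (A : set X) :
  measurable_fun setT T ->
  (forall B, measurable B -> mu (T @^-1` B) = mu B) -> measurable A ->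
  {ae mu, forall x, A x -> forall m, exists2 n, (m <= n)%N & A (iter n T x)}.
Proof.
move=> mT muT mA.
pose B m := \bigcup_(n in [set n | (m <= n)%N]) (iter n T @^-1` A).
have miter n : measurable_fun setT (iter n T).
  elim: n => [|n IH]; first exact: measurable_id.
  exact: measurableT_comp mT IH.
have mB m : measurable (B m).
  apply: bigcup_measurable => n _.
  by rewrite -[X in measurable X]setTI; exact: miter.
have TB m : T @^-1` B m = B m.+1.
  apply/seteqP; split=> x.
    by case=> n mn An; exists n.+1 => //=; rewrite -iterS iterSr.
  by case=> -[//|n] mn An; exists n => //=; rewrite /= -iterSr.
have BS m : B m.+1 `<=` B m.
  by move=> x [n mn An]; exists n => //; exact: ltnW.
have muBS m : mu (B m `\` B m.+1) = 0%E.
  rewrite measureD//; last by rewrite -ge0_fin_numE// fin_num_measure.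
  rewrite setIidr; last exact: BS.
  have e : mu (B m.+1) = mu (B m) by rewrite -TB muT.
  apply: etrans (subee (fin_num_measure mu _ (mB m))).
  by congr (_ - _)%E; exact: e.
have : mu.-negligible (\bigcup_m (B m `\` B m.+1)).
  apply: negligible_bigcup => m.
  by apply/negligibleP; [exact: measurableD|exact: muBS].
apply: negligibleS => x /= /existsNP[Ax] /existsNP[m Bm].
have nB : ~ B m x by case=> n mn An; apply: Bm; exists n.
(* A point of [A] is in [B 0]; if it is missing from a later set, it drops out at some step. *)
elim: m nB {Bm} => [|m IH] nB; first by exfalso; apply: nB; exists 0%N.
by have [Bmx|/IH//] := pselect (B m x); exists m.
Qed.

Lemma ae_forall_nat (R : realType) d (X : measurableType d)
    (mu : probability X R) (Q : nat -> X -> Prop) :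
  (forall i, {ae mu, forall x, Q i x}) -> {ae mu, forall x, forall i, Q i x}.
Proof.
move=> aeQ; have : mu.-negligible (\bigcup_i ~` [set x | Q i x]).
  exact: negligible_bigcup.
by apply: negligibleS => x /= /existsNP[i Qi]; exists i.
Qed.

Section bounded_im_mul.
Context {R : realType}.

(** Expanding the first factor in the standard basis leaves seven linear maps of the second, each
    bounded because the dimension is finite. *)
Lemma im_mul_norm_bounded (n : 'cV[R]_7 -> R) : is_norm n ->
  exists2 K, 0 <= K & im_mul_bounded n K.
Proof.
move=> nn; have sn := norm_is_seminorm nn.
have sim v : is_seminorm (fun w => n (im_mul v w)).
  split=> [w w'|r w]; first by rewrite linearD; exact: seminormD.
  by rewrite linearZ /= (seminormZ sn).
pose e i : 'cV[R]_7 := delta_mx i 0.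
have /choice[K KP] i : exists K, 0 <= K /\ forall w, n (im_mul (e i) w) <= K * n w.
  by have [K K0 KP] := seminorm_le_norm (sim (e i)) nn; exists K.
pose l1 (v : 'cV[R]_7) := \sum_i `|v i 0|.
have sl1 : is_seminorm l1.
  split=> [v w|r v]; rewrite /l1.
    by rewrite -big_split; apply: ler_sum => i _; rewrite mxE ler_normD.
  by rewrite mulr_sumr; apply: eq_bigr => i _; rewrite mxE normrM.
have [K0 K00 K0P] := seminorm_le_norm sl1 nn.
have sK0 : 0 <= \sum_i K i by apply: sumr_ge0 => i _; have [] := KP i.
exists (K0 * \sum_i K i) => [|v w]; first exact: mulr_ge0.
have : n (im_mul v w) <= l1 v * ((\sum_i K i) * n w).
  rewrite {1}[v]matrix_sum_delta -/(im_mulr w _) linear_sum.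
  apply: le_trans (seminorm_sum _ _ _ sn) _; rewrite mulr_suml.
  apply: ler_sum => i _; rewrite big_ord1 linearZ /= (seminormZ sn).
  apply: ler_wpM2l => //; apply: le_trans ((KP i).2 w) _.
  apply: ler_wpM2r; first exact: seminorm_ge0.
  rewrite (bigD1 i)//= lerDl; apply: sumr_ge0 => j _.
  by have [] := KP j.
move/le_trans; apply.
rewrite [leRHS](_ : _ = K0 * n v * ((\sum_i K i) * n w)); last by ring.
by apply: ler_wpM2r => //; rewrite mulr_ge0// seminorm_ge0.
Qed.

End bounded_im_mul.


(** * The fiber norm read in a frame *)

Section frame_norm.
Context {R : realType} {dX dP : measure_display} {X : measurableType dX}
  {P : measurableType dP} {B : principal_bundle R X P} (N : bundle_norm B).

Definition frame_norm (p : P) (v : 'cV[R]_7) : R :=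
  N _ (W_of (erefl (proj B p)) v).

Lemma frame_normE x p (px : proj B p = x) v : N x (W_of px v) = frame_norm p v.
Proof. by case: x / px. Qed.

Lemma frame_norm_act p a v :
  frame_norm (act B p a) v = frame_norm p (rho_std a *m v).
Proof.
rewrite -(frame_normE (proj_act B p a)) /frame_norm.
rewrite -(W_of_act erefl (proj_act B p a)); congr (N _ (W_of _ _)).
by rewrite mulmxA -rho_stdM mulVg rho_std1 mul1mx.
Qed.

Lemma frame_norm_is_norm p : is_norm (frame_norm p).
Proof.
split; first split=> [v w|r v].
- by rewrite /frame_norm W_ofD; exact: ler_bnormD.
- by rewrite /frame_norm W_ofZ; exact: bnormZ.
- move=> v /bnorm0_eq0 v0; apply: (W_of_inj (px := erefl (proj B p))).
  apply: etrans v0 _; rewrite -[0 in RHS](scale0r (0 : 'cV[R]_7)) W_ofZ.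
  by rewrite scale0r.
Qed.

Lemma measurable_frame_norm (U : set X) (s : X -> P) v :
  measurable_fun U s -> measurable_fun U (fun x => frame_norm (s x) v).
Proof.
move=> ms; apply: (@measurableT_comp _ _ _ _ _ _ (frame_norm^~ v)) ms.
apply: (measurableT_comp (measurable_bnorm N)
  (g := fun p => (p, v : borel_mx R 7 1))).
exact: measurable_fun_pair.
Qed.

(** Changing the frame acts by an octonion automorphism, which preserves the product; the bound
    therefore depends on the fiber only. *)
Lemma frame_norm_im_mul_act p a K : im_mul_bounded (frame_norm p) K ->
  im_mul_bounded (frame_norm (act B p a)) K.
Proof.
move=> Kp v w; rewrite !frame_norm_act octonion_aut_im_mul//.
exact: asboolW (G2_mxP a).
Qed.

End frame_norm.

(** * Recurrence of the product bound along orbits *)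

Section recurrence.
Context {R : realType} {dX dP : measure_display} {X : measurableType dX}
  {P : measurableType dP} {B : principal_bundle R X P} (N : bundle_norm B).

Definition im_mul_bounded_at (K : R) (x : X) :=
  forall p, proj B p = x -> im_mul_bounded (frame_norm N p) K.

Lemma im_mul_bounded_cover : exists A : nat -> nat -> set X,
  [/\ forall i K, measurable (A i K), \bigcup_i \bigcup_K A i K = setT &
    forall i K x, A i K x -> im_mul_bounded_at K%:R x].
Proof.
have [U [mU UT /choice[s /choice[h sh]]]] := locally_trivial B.
pose ineq (x : X) (s : X -> P) (K : R) (z : 'cV[rat]_7 * 'cV[rat]_7) :=
  frame_norm N (s x) (im_mul (map_mx ratr z.1) (map_mx ratr z.2)) <=
  K * (frame_norm N (s x) (map_mx ratr z.1) *
       frame_norm N (s x) (map_mx ratr z.2)).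
(* The bound is imposed in the local section [s i] on all pairs of rational vectors, enumerated by
   their codes. A [k] that codes no pair contributes [U i]. *)
exists (fun i K => \bigcap_k (if unpickle k is Some z then
  U i `&` [set x | ineq x (s i) K%:R z] else U i)); split.
- move=> i K; apply: bigcapT_measurable => k; case: unpickle => // z.
  have [ms _ _ _] := sh i.
  apply: measurable_fun_le => //; first exact: measurable_frame_norm.
  apply: measurable_funM; first exact: measurable_cst.
  by apply: measurable_funM; exact: measurable_frame_norm.
- rewrite -subTset => x _; have [i _ Uix] : (\bigcup_i U i) x by rewrite UT.
  have [K K0 KP] := im_mul_norm_bounded (frame_norm_is_norm N (s i x)).
  exists i => //; exists (Num.truncn K).+1 => // k _.
  case: unpickle => // z; split=> //.
  apply: le_trans (KP _ _) _; apply: ler_wpM2r.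
    by rewrite mulr_ge0// seminorm_ge0//; exact/norm_is_seminorm/frame_norm_is_norm.
  by apply/ltW; rewrite truncnS_gt.
- move=> i K x Ax; have Uix : U i x by have := Ax 0%N I; case: unpickle => // z [].
  have [_ _ sx _] := sh i.
  have rat_ineq z : ineq x (s i) K%:R z.
    by have := Ax (pickle z) I; rewrite pickleK => -[].
  have sn := norm_is_seminorm (frame_norm_is_norm N (s i x)).
  have K0 : 0 <= K%:R :> R by [].
  have scaled c : 0 <= c -> is_seminorm (fun v => c * frame_norm N (s i x) v).
    move=> c0; split=> [v w|r v].
      by rewrite -mulrDr ler_wpM2l// (seminormD sn).
    by rewrite (seminormZ sn) mulrCA.
  have simr w : is_seminorm (fun v => frame_norm N (s i x) (im_mul v w)).
    split=> [v v'|r v]; rewrite -!/(im_mulr w _).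
      by rewrite linearD; exact: (seminormD sn).
    by rewrite linearZ /= (seminormZ sn).
  have siml v : is_seminorm (fun w => frame_norm N (s i x) (im_mul v w)).
    split=> [w w'|r w]; first by rewrite linearD; exact: (seminormD sn).
    by rewrite linearZ /= (seminormZ sn).
  have bound : im_mul_bounded (frame_norm N (s i x)) K%:R.
    have c0 u : 0 <= K%:R * frame_norm N (s i x) u.
      by rewrite mulr_ge0// (seminorm_ge0 _ sn).
    (* The bound passes from rational to real vectors one factor at a time. *)
    move=> v w; rewrite mulrA; move: w.
    apply: (seminorm_le_rat (siml v) (scaled _ (c0 v))) => w'.
    rewrite mulrAC; move: v.
    apply: (seminorm_le_rat (simr _) (scaled _ (c0 _))) => v'.
    by rewrite mulrAC -mulrA; exact: (rat_ineq (v', w')).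
  move=> p px; have [a ->] : exists a, p = act B (s i x) a.
    by apply: act_transitive; rewrite sx.
  exact: frame_norm_im_mul_act.
Qed.

Lemma im_mul_recurrence (mu : probability X R) (g : R -> X -> X) :
  ergodic_flow mu g ->
  {ae mu, forall x, exists K,
    (forall T, exists2 t, T < t & im_mul_bounded_at K (g t x)) /\
    (forall T, exists2 t, T < t & im_mul_bounded_at K (g (- t) x))}.
Proof.
move=> [[g0 gD mg] gmu _].
have mgt t : measurable_fun setT (g t).
  exact: (measurableT_comp mg (pair1_measurable t)).
have iterg t n x : iter n (g t) x = g (n%:R * t) x.
  elim: n => [|n IH]; first by rewrite mul0r g0.
  by rewrite iterS IH -gD -natr1 mulrDl mul1r addrC.
have [A [mA AT AK]] := im_mul_bounded_cover.
have rec t i K := poincare_recurrence (mgt t) (gmu t) (mA i K).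
have recN t : {ae mu, forall x, forall i K, A i K x ->
    forall m, exists2 n, (m <= n)%N & A i K (iter n (g t) x)}.
  by apply: ae_forall_nat => i; exact: ae_forall_nat.
(* The maps of time 1 and -1 bring almost every point back to the set [A i K] that contains it. *)
move: (recN 1) (recN (-1)); apply: filterS2 => x rec1 recN1.
have [i _ [K _ Ax]] : (\bigcup_i \bigcup_K A i K) x by rewrite AT.
exists K%:R; split=> T.
  have [n mn An] := rec1 i K Ax (Num.truncn T).+1; exists n%:R.
    by apply: lt_le_trans (truncnS_gt _) _; rewrite ler_nat.
  by apply: (AK i); rewrite -[n%:R]mulr1 -iterg.
have [n mn An] := recN1 i K Ax (Num.truncn T).+1; exists n%:R.
  by apply: lt_le_trans (truncnS_gt _) _; rewrite ler_nat.
by apply: (AK i); rewrite -mulrN1 -iterg.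
Qed.

End recurrence.

Lemma ae_ex (R : realType) d (X : measurableType d) (mu : probability X R)
    (Q : X -> Prop) : {ae mu, forall x, Q x} -> exists x, Q x.
Proof.
move=> aeQ; apply: contrapT => /forallNP nQ.
have : mu.-negligible [set: X] by apply: negligibleS aeQ => x _; exact: nQ.
move/(measure_negligible measurableT) => mu0.
case: (etrans (esym mu0) (probability_setT mu)) => /esym/eqP.
by rewrite oner_eq0.
Qed.

(** This is the list of exponents as seen from a single orbit. *)
Definition growth_spectrum (R : realType) (n : R -> 'cV[R]_7 -> R) (s : seq R) :=
  exists A Q d, [/\ Q \in unitmx, A *m Q = Q *m diag_mx d, exp_growth2 n A &
    [seq d 0 i | i <- enum 'I_7] = s].

(** * The Oseledets splitting read in a frame *)

Section lyapunov_frame.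
Context {R : realType} {dX dP : measure_display} {X : measurableType dX}
  {P : measurableType dP} {B : principal_bundle R X P} {g : R -> X -> X}
  (phi : flow_lift B g) (N : bundle_norm B).

Lemma W_of_sum x p (px : proj B p = x) (I : Type) (r : seq I) (c : I -> R)
    (F : I -> 'cV[R]_7) :
  W_of px (\sum_(i <- r) c i *: F i) = \sum_(i <- r) c i *: W_of px (F i).
Proof.
have W0 : W_of px 0 = 0 by rewrite -(scale0r (0 : 'cV[R]_7)) W_ofZ scale0r.
rewrite (big_morph (W_of px) (W_ofD px) W0).
by apply: eq_bigr => i _; rewrite W_ofZ.
Qed.

Lemma splitting_growth_spectrum x p (px : proj B p = x) (m : nat)
    (chi : 'I_m -> R) (V : 'I_m -> {vspace W_std B x}) :
  (forall i j : 'I_m, (i < j)%N -> chi j < chi i) ->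
  (\sum_(i < m) V i = fullv)%VS -> directv (\sum_(i < m) V i)%VS ->
  (forall i v, v \in V i -> v != 0 ->
    (ln (N _ (W_flow phi t v)) / t @[t --> +oo] --> chi i) /\
    (ln (N _ (W_flow phi t v)) / t @[t --> -oo] --> chi i)) ->
  growth_spectrum (fun t => frame_norm N (phi t p))
    (flatten [seq nseq (\dim (V i)) (chi i) | i <- enum 'I_m]).
Proof.
move=> chi_lt Vfull Vdir Vgrowth; set s := flatten _.
have chi_inj : injective chi.
  move=> i j ij; case: (ltngtP i j) => [/chi_lt|/chi_lt|/ord_inj//].
    by rewrite ij ltxx.
  by rewrite ij ltxx.
(* Bases of the spaces are concatenated, each vector paired with its exponent. *)
pose L := flatten [seq [seq (v, chi i) | v <- vbasis (V i)] | i <- enum 'I_m].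
have L2 : unzip2 L = s.
  rewrite /unzip2 map_flatten -map_comp; congr flatten; apply: eq_map => i /=.
  rewrite -map_comp -[in RHS](size_tuple (vbasis (V i))).
  by elim: (tval _) => //= v r ->.
have Lbasis : basis_of fullv (unzip1 L).
  have -> : unzip1 L = \big[cat/[::]]_(i < m) vbasis (V i).
    rewrite /unzip1 map_flatten -map_comp /flatten foldrE big_map enumT /=.
    rewrite [index_enum _]unlock.
    apply: eq_bigr => i _; rewrite -map_comp /=.
    exact: map_id.
  by rewrite -Vfull; apply: bigcat_basis => // i _; exact: vbasisP.
have Lsize : size (unzip1 L) == 7%N.
  have := size_basis (X := in_tuple (unzip1 L)) Lbasis.
  by rewrite dimvf => e; apply/eqP/(etrans (esym e)).
have ssize : size s = 7%N.
  by rewrite -L2 -(eqP Lsize) !size_map.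
pose b := Tuple Lsize.
have Lmem (j : 'I_7) : exists2 i, b`_j \in V i & s`_j = chi i.
  have jL : (j < size L)%N by move: (Lsize); rewrite size_map => /eqP ->.
  have : nth (0, 0) L j \in L by exact: mem_nth.
  case/flattenP => _ /mapP[i _ ->] /mapP[v vV E]; exists i.
    by rewrite /= (nth_map (0, 0)) ?E//; exact: vbasis_mem.
  by rewrite -L2 (nth_map (0, 0)) ?E.
pose Q : 'M[R]_7 := \matrix_(r, j) Defs.coord px b`_j r 0.
have colQ j : W_of px (col j Q) = b`_j.
  rewrite -[RHS](coordK px); congr W_of.
  by apply/colP => r; rewrite !mxE.
pose d : 'rV[R]_7 := \row_j s`_j.
have WQ y : W_of px (Q *m y) = \sum_j y j 0 *: b`_j.
  by rewrite mulmx_sum_col W_of_sum; apply: eq_bigr => j _; rewrite colQ.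
have uQ : Q \in unitmx.
  pose C : 'M[R]_7 := \matrix_(j, k) vector.coord b j (W_of px (delta_mx k 0)).
  have : Q *m C = 1%:M.
    have QC k : Q *m col k C = delta_mx k 0.
      apply: (W_of_inj (px := px)); rewrite WQ.
      rewrite [RHS](coord_basis (X := b) Lbasis (memvf _)).
      by apply: eq_bigr => j _; rewrite !mxE.
    apply/matrixP => r k; have := congr1 (fun v : 'cV_7 => v r 0) (QC k).
    by rewrite mulmx_col !mxE eqxx andbT.
  by case/mulmx1_unit.
pose A := Q *m diag_mx d *m invmx Q.
have AQ : A *m Q = Q *m diag_mx d by rewrite mulmxKV.
exists A, Q, d; split=> //.
  (* An eigenvector for [c] involves only basis vectors of exponent [c]. As [chi] is injective,
     these all lie in one Oseledets space, whose growth rate applies. *)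
  move=> c u u0 Au; pose y := invmx Q *m u.
  have uE : u = Q *m y by rewrite mulKVmx.
  have dy j : y j 0 != 0 -> s`_j = c.
    move=> yj; have : diag_mx d *m y = c *: y.
      by rewrite /y scalemxAr -Au /A !mulmxA mulVmx// mul1mx.
    move/(congr1 (fun v : 'cV_7 => v j 0)); rewrite mul_diag_mx mxE [RHS]mxE mxE.
    by move=> e; exact: (mulIf yj).
  have [j0 yj0] : exists j, y j 0 != 0.
    apply/existsP; apply: contraNT u0 => /existsPn y0.
    rewrite uE; suff -> : y = 0 by rewrite mulmx0.
    by apply/colP => j; rewrite [RHS]mxE; apply/eqP; have := y0 j; rewrite negbK.
  have [i bi si] := Lmem j0.
  have WuV : W_of px u \in V i.
    rewrite uE WQ; apply: memv_suml => j _.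
    have [->|yj] := eqVneq (y j 0) 0; first by rewrite scale0r mem0v.
    apply: memvZ; have [i' bi' si'] := Lmem j.
    suff -> : i = i' by [].
    by apply: chi_inj; rewrite -si -si' !dy.
  have Wu0 : W_of px u != 0.
    apply: contra_neq u0 => Wu0; apply: (W_of_inj (px := px)); rewrite Wu0.
    by rewrite -[0 in RHS](scale0r (0 : 'cV[R]_7)) W_ofZ scale0r.
  have := Vgrowth i _ WuV Wu0; rewrite -si dy//.
  suff -> : (fun t => ln (N _ (W_flow phi t (W_of px u))) / t) =
     (fun t => ln (frame_norm N (phi t p) u) / t) by [].
  by apply/funext => t; rewrite W_flowE frame_normE.
transitivity (map (nth 0 s) (map val (enum 'I_7))).
  by rewrite -map_comp; apply: eq_map => i; rewrite mxE.
by rewrite val_enum_ord -ssize; exact: mkseq_nth.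
Qed.

End lyapunov_frame.

(** * The shape of the Lyapunov spectrum *)

Theorem proposition2p1 (R : realType) (dX dP : measure_display)
    (X : measurableType dX) (P : measurableType dP) (mu : probability X R)
    (g : R -> X -> X) (g_ergodic : ergodic_flow mu g)
    (B : principal_bundle R X P) (phi : flow_lift B g) (N : bundle_norm B)
    (phi_integrable : integrable_lift phi mu N) :
  exists l1 l2 l3 : R, forall s : seq R, lyapunov_exponents phi mu N s ->
    perm_eq s [:: 0; l1 - l2; - (l1 - l2); l1 - l3; - (l1 - l3);
                  l2 - l3; - (l2 - l3)].
Proof.
have spectrum s : lyapunov_exponents phi mu N s ->
    {ae mu, forall x, forall p, proj B p = x ->
      growth_spectrum (fun t => frame_norm N (phi t p)) s}.
  case=> m [chi [V [n [[chi_lt _ Vdir _ Vgrowth] _ dimV sE]]]].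
  apply: filterS3 Vdir Vgrowth dimV => x [Vfull Vd] Vg Vn p px.
  have -> : s = flatten [seq nseq (\dim (V i x)) (chi i) | i <- enum 'I_m].
    by rewrite sE; congr flatten; apply: eq_map => i; rewrite Vn.
  exact: (splitting_growth_spectrum px).
have nn p t : is_norm (frame_norm N (phi t p)) by exact: frame_norm_is_norm.
(* The three numbers must be fixed before [s] is given, so they are taken from a reference list
   [s0]; if there is no list at all, any numbers do. *)
have [[s0 /spectrum ae0]|no_s] := pselect (exists s, lyapunov_exponents phi mu N s);
  last by exists 0, 0, 0 => s ls; case: no_s; exists s.
have [x [sp0 [K [Kp Kn]]]] : exists x, (forall p, proj B p = x ->
    growth_spectrum (fun t => frame_norm N (phi t p)) s0) /\
  exists K, (forall T, exists2 t, T < t & im_mul_bounded_at N K (g t x)) /\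
    (forall T, exists2 t, T < t & im_mul_bounded_at N K (g (- t) x)).
  apply: (@ae_ex _ _ _ mu); apply: filterS2 ae0 (im_mul_recurrence N g_ergodic).
  by move=> x.
have [p px] := frame_exists B x.
have [A [Q [d [uQ AQ gA dE]]]] := sp0 p px.
have derA : im_derivation A.
  apply: (growth_im_derivation (nn p) uQ AQ gA (K := K)) => T.
    have [t Tt Kt] := Kp T; exists t => //; apply: Kt.
    exact: lift_over.
  have [t Tt Kt] := Kn T; exists t => //; apply: Kt.
  exact: lift_over.
have [l1 [l2 [l3 l_s0]]] := im_derivation_spectrum derA uQ AQ.
exists l1, l2, l3 => s /spectrum aes; apply: (perm_trans _ l_s0); rewrite dE.
(* The exceptional null set depends on [s], so a new point [y], good for both [s0] and [s], is
   chosen to compare the two lists. *)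
have [y [sp0y sp_y]] : exists y, (forall p, proj B p = y ->
    growth_spectrum (fun t => frame_norm N (phi t p)) s0) /\
  (forall p, proj B p = y ->
    growth_spectrum (fun t => frame_norm N (phi t p)) s).
  by apply: (@ae_ex _ _ _ mu); apply: filterS2 ae0 aes => y.
have [q qy] := frame_exists B y.
have [A0 [Q0 [d0 [uQ0 AQ0 gA0 <-]]]] := sp0y q qy.
have [A1 [Q1 [d1 [uQ1 AQ1 gA1 <-]]]] := sp_y q qy.
exact: (growth_spectrum_unique (nn q) uQ1 AQ1 gA1 uQ0 AQ0 gA0).
Qed.
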